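(* There are a computable measure preserving transformation $\tau$ of $[0,1]$ under Lebesgue measure $\mu$ and a computable characteristic function $f=\chi_A$ such that, if $f^*=\lim_n A_nf$ (limit in $L^2([0,1])$), then $\|f^*\|_2$ is not a computable real number. In particular, $f^*$ is not a computable element of the Hilbert space $L^2([0,1])$, and there is no computable bound on the rate of convergence of $(A_nf)$ in either the $L^2$ or the $L^1$ norm. Nor is there a computable bound on the pointwise rate of convergence of $(A_nf)$, i.e. there is no computable function which assigns to all rational $\lambda_1>0$, $\lambda_2>0$ an $n\ge 1$ such that for every $k\ge n$, $$\mu\Big(\Big\{x \;\Big|\; \max_{n\le m\le k}|A_mf(x)-A_nf(x)|>\lambda_1\Big\}\Big)\le\lambda_2 .$$
   Context: $Tf=f\circ\tau$ is the Koopman operator of $\tau$ and $A_nf=\frac1n\sum_{0\le i<n}T^if$ for $n\ge1$. A bound on the rate of convergence of $(A_nf)$ in a norm is a function $r$ from positive rationals to positive integers such that $\|A_mf-A_{r(\varepsilon)}f\|<\varepsilon$ for all rational $\varepsilon>0$ and all $m\ge r(\varepsilon)$. Computability conventions (standard computable analysis). A real number is computable if there are computable functions $a:\mathbb{N}\to\mathbb{Q}$ and $r:\mathbb{Q}\to\mathbb{N}$ such that $a_n$ converges to it and $|a_m-a_{r(\varepsilon)}|<\varepsilon$ for every rational $\varepsilon>0$ and $m\ge r(\varepsilon)$. An element of $L^2([0,1])$ is computable if there are a computable sequence of simple functions (finite rational linear combinations of characteristic functions of intervals with rational endpoints) converging to it in the $L^2$ norm and a computable bound on the rate of convergence. A measurable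 function is likewise represented, up to a.e. equality, by a sequence of such simple functions approximating it in the $L^1$ norm together with a rate of convergence, and is computable if it has a computable representation. A bounded linear operator is computable if the sequence of its values on (an enumeration of) the simple functions is computable, uniformly. A measure preserving transformation $\tau$ is computable if its Koopman operator $Tf=f\circ\tau$ is. *)

(* Defs.v *)
From Stdlib Require Cantor.
From mathcomp Require Import all_boot all_order all_algebra.
From mathcomp Require Import all_classical all_reals all_analysis.

Set Implicit Arguments.
Unset Strict Implicit.
Unset Printing Implicit Defensive.
Import Order.TTheory GRing.Theory Num.Theory.
Import numFieldNormedType.Exports.
Local Open Scope classical_set_scope.
Local Open Scope ring_scope.

(* Partial recursive functions on nat. They are taken unary; several arguments
   are packed with the Cantor bijection nat * nat <-> nat, whose projections
   and pairing are among the basic operations. *)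

Definition cpair (a b : nat) : nat := Cantor.to_nat (a, b).
Definition cfst (n : nat) : nat := fst (Cantor.of_nat n).
Definition csnd (n : nat) : nat := snd (Cantor.of_nat n).

Inductive prog : Type :=
| PZero
| PSucc
| PFst
| PSnd
| PPair of prog & prog
| PComp of prog & prog
| PRec of prog & prog
| PMin of prog.

(* [eval c n v]: the program c on input n halts with output v.
   [PRec c d] is primitive recursion, on input (x, k):
     h (x, 0) = c x  and  h (x, k + 1) = d (x, (k, h (x, k)));
   [PMin c] is unbounded minimization of v |-> c (n, v). *)
Fixpoint eval (c : prog) (n v : nat) {struct c} : Prop :=
  match c with
  | PZero => v = 0%N
  | PSucc => v = n.+1
  | PFst => v = cfst n
  | PSnd => v = csnd n
  | PPair c d => exists a b, [/\ eval c n a, eval d n b & v = cpair a b]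
  | PComp c d => exists2 w, eval d n w & eval c w v
  | PRec c d =>
      (fix loop (k w : nat) {struct k} : Prop :=
         match k with
         | 0 => eval c (cfst n) w
         | k'.+1 => exists2 u, loop k' u & eval d (cpair (cfst n) (cpair k' u)) w
         end) (csnd n) v
  | PMin c => eval c (cpair n v) 0
              /\ forall m, (m < v)%N -> exists w, eval c (cpair n m) w.+1
  end.

Definition computable_nat (f : nat -> nat) : Prop :=
  exists c : prog, forall n, eval c n (f n).

(* n = ((p, q), d) codes the rational (p - q) / (d + 1); every rational has a
   code, and functions from or to rat are computable when they are so on codes *)
Definition rat_of_code (n : nat) : rat :=
  ((cfst (cfst n))%:R - (csnd (cfst n))%:R) / (csnd n).+1%:R.

Definition computable_rat_seq (a : nat -> rat) : Prop :=
  exists2 g, computable_nat g & forall n, a n = rat_of_code (g n).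

Definition computable_rat_nat (r : rat -> nat) : Prop :=
  computable_nat (fun n => r (rat_of_code n)).

Definition computable_rat2_nat (r : rat -> rat -> nat) : Prop :=
  computable_nat (fun n => r (rat_of_code (cfst n)) (rat_of_code (csnd n))).

Definition computable_nat2_nat (s : nat -> nat -> nat) : Prop :=
  computable_nat (fun n => s (cfst n) (csnd n)).

Definition computable_nat_rat_nat (r : nat -> rat -> nat) : Prop :=
  computable_nat (fun n => r (cfst n) (rat_of_code (csnd n))).

Definition computable_real (R : realType) (x : R) : Prop :=
  exists (a : nat -> rat) (r : rat -> nat),
    [/\ computable_rat_seq a, computable_rat_nat r,
        (ratr (a n) : R) @[n --> \oo] --> x
      & forall eps : rat, 0 < eps -> forall m, (r eps <= m)%N ->
          `|a m - a (r eps)| < eps].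

(* e = (k, (t_0, (t_1, ... (t_(k-1), _)))) codes the list of the k triples
   t_i = (c_i, (a_i, b_i)) of rationals *)
Definition simple_terms (e : nat) : seq (rat * (rat * rat)) :=
  [seq (let t := cfst (iter i csnd (csnd e)) in
        (rat_of_code (cfst t),
         (rat_of_code (cfst (csnd t)), rat_of_code (csnd (csnd t)))))
  | i <- iota 0 (cfst e)].

(* The simple function \sum_i c_i \1_[a_i, b_i]. Closed intervals, with
   a_i = b_i allowed, have the same rational combinations as all bounded
   intervals with rational endpoints. *)
Definition simple_fun (R : realType) (e : nat) (x : R) : R :=
  \sum_(t <- simple_terms e)
     ratr t.1 * \1_(`[ratr t.2.1 : R, ratr t.2.2]) x.

(* Functions on [0, 1] are given by functions on R, of which only the
   restriction to [0, 1] is used. *)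
Definition I01 (R : realType) : set R := `[0, 1].

Definition Lp_norm (R : realType) (p : R) (f : R -> R) : \bar R :=
  'N[@lebesgue_measure R]_(p%:E)[EFin \o (f \_ (@I01 R))].

Definition in_Lp (R : realType) (p : R) (f : R -> R) : Prop :=
  (f \_ (@I01 R)) \in Lfun (@lebesgue_measure R) p%:E.

Definition cvg_Lp (R : realType) (p : R) (u : nat -> R -> R) (f : R -> R) :
    Prop :=
  Lp_norm p (u n \- f) @[n --> \oo] --> 0%E.

Definition rate_Lp (R : realType) (p : R) (u : nat -> R -> R) (r : rat -> nat) :
    Prop :=
  forall eps : rat, 0 < eps -> forall m, (r eps <= m)%N ->
    (Lp_norm p (u m \- u (r eps))%R < (ratr eps)%:E)%E.

Definition computable_Lp (R : realType) (p : R) (f : R -> R) : Prop :=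
  in_Lp p f /\
  exists (s : nat -> nat) (r : rat -> nat),
    [/\ computable_nat s, computable_rat_nat r,
        cvg_Lp p (fun n => @simple_fun R (s n)) f
      & rate_Lp p (fun n => @simple_fun R (s n)) r].

Definition computable_measurable_fun (R : realType) (f : R -> R) : Prop :=
  computable_Lp 1 f.

(* The same, uniformly in the index e of the sequence F. *)
Definition computable_L2_seq (R : realType) (F : nat -> R -> R) : Prop :=
  (forall e, in_Lp 2 (F e)) /\
  exists (s : nat -> nat -> nat) (r : nat -> rat -> nat),
    [/\ computable_nat2_nat s, computable_nat_rat_nat r,
        forall e, cvg_Lp 2 (fun n => @simple_fun R (s e n)) (F e)
      & forall e, rate_Lp 2 (fun n => @simple_fun R (s e n)) (r e)].

Definition computable_operator (R : realType) (U : (R -> R) -> (R -> R)) :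
    Prop :=
  computable_L2_seq (fun e => U (@simple_fun R e)).

Definition measure_preserving01 (R : realType) (tau : R -> R) : Prop :=
  [/\ measurable_fun (@I01 R) tau,
      forall x, I01 x -> I01 (tau x)
    & forall B : set R, measurable B -> B `<=` @I01 R ->
        lebesgue_measure (@I01 R `&` tau @^-1` B) = lebesgue_measure B].

Definition koopman (R : realType) (tau : R -> R) (f : R -> R) : R -> R :=
  f \o tau.

Definition computable_transformation (R : realType) (tau : R -> R) : Prop :=
  computable_operator (koopman tau).

(* For n = 0 this is the zero function; the statement only uses n >= 1. *)
Definition ergodic_avg (R : realType) (tau : R -> R) (f : R -> R) (n : nat) :
    R -> R :=
  fun x => n%:R^-1 * \sum_(0 <= i < n) iter i (koopman tau) f x.

Definition avg_rate_Lp (R : realType) (p : R) (tau f : R -> R)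
    (r : rat -> nat) : Prop :=
  (forall eps : rat, 0 < eps -> (0 < r eps)%N) /\
  rate_Lp p (ergodic_avg tau f) r.

Definition max_deviation (R : realType) (tau f : R -> R) (n k : nat) (x : R) : R :=
  \big[Num.max/0]_(n <= m < k.+1)
     `|ergodic_avg tau f m x - ergodic_avg tau f n x|.

Definition avg_pointwise_rate (R : realType) (tau f : R -> R)
    (N : rat -> rat -> nat) : Prop :=
  forall l1 l2 : rat, 0 < l1 -> 0 < l2 ->
    (0 < N l1 l2)%N /\
    forall k, (N l1 l2 <= k)%N ->
      (lebesgue_measure
         [set x | I01 x /\ (ratr l1 < max_deviation tau f (N l1 l2) k x)%R]
       <= (ratr l2)%:E)%E.

(* Main.v *)
Require Import Defs.
From Stdlib Require Cantor.
From mathcomp Require Import all_boot all_order all_algebra.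
From mathcomp Require Import zify ring lra.
From mathcomp Require Import all_classical all_reals all_analysis.
From mathcomp Require Import measurable_realfun.
Import Order.TTheory GRing.Theory Num.Theory.
Import numFieldNormedType.Exports.
Local Open Scope classical_set_scope.
Local Open Scope ring_scope.

(* Cut [0, 1) into the cells [1 - 2^-i, 1 - 2^-(i+1)), and let A be the union
   of their left halves. If the i-th program, run on its own code, halts with
   output 0 at stage j, tau rotates the i-th cell by 1/(2 (j + 1)) of its
   length; otherwise tau is the identity there. Not knowing yet whether a
   program halts means not knowing a rotation by a small angle, which moves
   the indicator of an interval little in L2; so tau is computable. But the
   averages of the indicator of A converge to 1/2 on the cells of halting
   programs and to the indicator itself on the others: the norm of the limit,
   or its integral over a half cell, or a rate of convergence, each decides
   halting. A rate does so because, while n is small compared to j, the n-th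
   average is still 1 on the first quarter of the cell. *)

(** * Closure properties of computable functions *)

(** The angle is chosen so that j + 1 steps make exactly a half turn. So tau has finite period on
    each halting cell, orbit averages over whole periods equal 1/2 exactly, and the limit is
    explicit without any ergodic theorem. For the Koopman operator, the error must be controlled for
    every simple function without knowing which programs halt. A small forward shift changes a
    simple function only just below its endpoints and just below the wrap-around points of the
    cells. At stage n the measure of that set is O(1/n), whatever the programs do later. The norm is
    harder than the local quantities, being one number to which all cells contribute. Two facts
    isolate cell i: the mass beyond the first i + 5 cells is small compared with the length of cell
    i, and the mass assigned to a cell can only drop as stages pass, so that the squared norm is
    approached from above. An approximation of the norm thus tells when a possible drop in cell i
    must already have been seen. *)

Lemma cfst_cpair a b : cfst (cpair a b) = a.
Proof. by rewrite /cfst /cpair Cantor.cancel_of_to. Qed.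

Lemma csnd_cpair a b : csnd (cpair a b) = b.
Proof. by rewrite /csnd /cpair Cantor.cancel_of_to. Qed.

Lemma cpair_cfst_csnd n : cpair (cfst n) (csnd n) = n.
Proof. by rewrite /cfst /csnd /cpair -surjective_pairing Cantor.cancel_to_of.
  Qed.

Definition cpairE := (cfst_cpair, csnd_cpair).

Lemma eq_computable_nat (f g : nat -> nat) :
  f =1 g -> computable_nat f -> computable_nat g.
Proof. by move=> fg [c cf]; exists c => n; rewrite -fg. Qed.

Lemma computable_nat_id : computable_nat id.
Proof.
exists (PPair PFst PSnd) => n /=.
by exists (cfst n), (csnd n); rewrite cpair_cfst_csnd.
Qed.

Lemma computable_nat_comp f g :
  computable_nat f -> computable_nat g -> computable_nat (fun n => f (g n)).
Proof. by move=> [c cf] [d dg]; exists (PComp c d) => n /=; exists (g n). Qed.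

Lemma computable_nat_pair f g : computable_nat f -> computable_nat g ->
  computable_nat (fun n => cpair (f n) (g n)).
Proof.
by move=> [c cf] [d dg]; exists (PPair c d) => n /=; exists (f n), (g n).
Qed.

Lemma computable_nat_fst f :
  computable_nat f -> computable_nat (fun n => cfst (f n)).
Proof. by apply: (@computable_nat_comp cfst f); exists PFst. Qed.

Lemma computable_nat_snd f :
  computable_nat f -> computable_nat (fun n => csnd (f n)).
Proof. by apply: (@computable_nat_comp csnd f); exists PSnd. Qed.

Lemma computable_nat_succ f :
  computable_nat f -> computable_nat (fun n => (f n).+1).
Proof. by apply: (@computable_nat_comp succn f); exists PSucc. Qed.

Lemma computable_nat_const k : computable_nat (fun=> k).
Proof.
elim: k => [|k IHk]; first by exists PZero.
exact: computable_nat_succ.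
Qed.

Lemma computable_nat_comp2 f g h : computable_nat2_nat f ->
  computable_nat g -> computable_nat h -> computable_nat
    (fun n => f (g n) (h n)).
Proof.
move=> cf cg ch.
have := computable_nat_comp _ _ cf (computable_nat_pair _ _ cg ch).
by apply: eq_computable_nat => n; rewrite !cpairE.
Qed.

Lemma computable_nat_rec (b N : nat -> nat) (s : nat -> nat -> nat -> nat) :
  computable_nat b ->
  computable_nat (fun z => s (cfst z) (cfst (csnd z)) (csnd (csnd z))) ->
  computable_nat N ->
  computable_nat (fun n => nat_rect (fun=> nat) (b n) (s n) (N n)).
Proof.
move=> [c cb] [d ds].
(* [PRec] recurses on the second component of its input, so the bound is first a free argument k;
   [N] is then substituted by composition. *)
suff : computable_nat2_nat (fun x k => nat_rect (fun=> nat) (b x) (s x) k).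
  by move=> /computable_nat_comp2 /(_ computable_nat_id); apply.
exists (PRec c d) => n /=.
elim: (csnd n) => [|k IHk] /=; first exact: cb.
exists (nat_rect (fun=> nat) (b (cfst n)) (s (cfst n)) k) => //.
by have := ds (cpair (cfst n) (cpair k (nat_rect (fun=> nat)
  (b (cfst n)) (s (cfst n)) k))); rewrite !cpairE.
Qed.

Lemma computable_nat_iter (b N f : nat -> nat) :
  computable_nat b -> computable_nat f -> computable_nat N ->
  computable_nat (fun n => iter (N n) f (b n)).
Proof.
move=> cb cf cN.
apply: (eq_computable_nat _ _ _ (computable_nat_rec b N (fun _ _ h => f h) cb _
  cN)) => [n|]; first by elim: (N n) => //= k ->.
apply: computable_nat_comp => //.
exact/computable_nat_snd/computable_nat_snd/computable_nat_id.
Qed.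

Definition computable_bool (P : nat -> bool) :=
  computable_nat (fun n => P n : nat).

(** Case analysis is a recursion whose step ignores the previous value. *)
Lemma computable_nat_case0 (c a b : nat -> nat) :
  computable_nat c -> computable_nat a -> computable_nat b ->
  computable_nat (fun n => if c n is 0 then a n else b n).
Proof.
move=> cc ca cb; apply: (eq_computable_nat _ _ _
  (computable_nat_rec a c (fun x _ _ => b x) ca _ cc)) => [n|];
    first by case: (c n).
by apply: computable_nat_comp => //; apply/computable_nat_fst/computable_nat_id.
Qed.

Lemma computable_nat_if (P : nat -> bool) (a b : nat -> nat) :
  computable_bool P -> computable_nat a -> computable_nat b ->
  computable_nat (fun n => if P n then a n else b n).
Proof.
move=> cP ca cb; have := computable_nat_case0 (fun n => P n) b a cP cb ca.
by apply: eq_computable_nat => n; case: (P n).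
Qed.

Lemma computable_nat_pred f :
  computable_nat f -> computable_nat (fun n => (f n).-1).
Proof.
move=> cf; apply: (@computable_nat_comp predn f) => //.
apply: (eq_computable_nat _ _ _ (computable_nat_rec (fun=> 0%N) id
  (fun _ k _ => k) (computable_nat_const 0) _ computable_nat_id)) => [[]//|].
exact/computable_nat_fst/computable_nat_snd/computable_nat_id.
Qed.

Lemma computable_nat_add f g : computable_nat f -> computable_nat g ->
  computable_nat (fun n => f n + g n)%N.
Proof.
move=> cf cg; have := computable_nat_iter f g succn cf.
move=> /(_ (computable_nat_succ id computable_nat_id) cg).
by apply: eq_computable_nat => n; rewrite iter_succn.
Qed.

Lemma computable_nat_sub f g : computable_nat f -> computable_nat g ->
  computable_nat (fun n => f n - g n)%N.
Proof.
move=> cf cg; have := computable_nat_iter f g predn cf.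
move=> /(_ (computable_nat_pred id computable_nat_id) cg).
by apply: eq_computable_nat => n; rewrite iter_predn.
Qed.

Lemma computable_nat_leq f g : computable_nat f -> computable_nat g ->
  computable_bool (fun n => f n <= g n)%N.
Proof.
move=> cf cg; have := computable_nat_case0 _ _ _ (computable_nat_sub _ _ cf cg)
  (computable_nat_const 1) (computable_nat_const 0).
by apply: eq_computable_nat => n; rewrite /leq; case: (_ - _)%N.
Qed.

Lemma computable_bool_neg P :
  computable_bool P -> computable_bool (fun n => ~~ P n).
Proof.
move=> cP; have := computable_nat_if P _ _ cP (computable_nat_const 0)
  (computable_nat_const 1).
by apply: eq_computable_nat => n; case: (P n).
Qed.

Lemma computable_bool_and P Q :
  computable_bool P -> computable_bool Q -> computable_bool
    (fun n => P n && Q n).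
Proof.
move=> cP cQ; have := computable_nat_if P _ _ cP cQ (computable_nat_const 0).
by apply: eq_computable_nat => n; case: (P n).
Qed.

Lemma computable_nat_eq f g : computable_nat f -> computable_nat g ->
  computable_bool (fun n => f n == g n).
Proof.
move=> cf cg; have := computable_bool_and _ _
  (computable_nat_leq _ _ cf cg) (computable_nat_leq _ _ cg cf).
by apply: eq_computable_nat => n; rewrite -eqn_leq.
Qed.

Lemma computable_nat_sum (F : nat -> nat -> nat) N :
  computable_nat2_nat F -> computable_nat N ->
  computable_nat (fun n => \sum_(0 <= k < N n) F n k)%N.
Proof.
move=> cF cN; apply: (eq_computable_nat _ _ _
  (computable_nat_rec (fun=> 0%N) N (fun x k h => h + F x k)%N
    (computable_nat_const 0) _ cN)) => [n|].
  by elim: (N n) => /= [|k ->]; [rewrite big_nil|rewrite big_nat_recr].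
apply: computable_nat_add.
  exact/computable_nat_snd/computable_nat_snd/computable_nat_id.
apply: computable_nat_comp2 => //.
  exact/computable_nat_fst/computable_nat_id.
exact/computable_nat_fst/computable_nat_snd/computable_nat_id.
Qed.

Lemma computable_nat_mul f g : computable_nat f -> computable_nat g ->
  computable_nat (fun n => f n * g n)%N.
Proof.
move=> cf cg; apply: (eq_computable_nat _ _ _
  (computable_nat_sum (fun n _ => f n) g _ cg)) => [n|].
  by rewrite sum_nat_const_nat subn0 mulnC.
by apply: computable_nat_comp => //; apply/computable_nat_fst/computable_nat_id.
Qed.

Lemma computable_nat_exp f g : computable_nat f -> computable_nat g ->
  computable_nat (fun n => f n ^ g n)%N.
Proof.
move=> cf cg; apply: (eq_computable_nat _ _ _
  (computable_nat_rec (fun=> 1%N) g (fun x _ h => f x * h)%N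
    (computable_nat_const 1) _ cg)) => [n|].
  by elim: (g n) => //= k ->; rewrite expnS.
apply: computable_nat_mul.
  by apply: computable_nat_comp => //;
    apply/computable_nat_fst/computable_nat_id.
exact/computable_nat_snd/computable_nat_snd/computable_nat_id.
Qed.

(** The quotient counts the k < f n with (k + 1) * g n <= f n; the guard on g n yields 0 for
    division by zero. *)
Lemma computable_nat_div f g : computable_nat f -> computable_nat g ->
  computable_nat (fun n => f n %/ g n)%N.
Proof.
move=> cf cg.
apply: (eq_computable_nat _ _ _ (computable_nat_sum
  (fun n k => ((0 < g n) && (k.+1 * g n <= f n)) : nat)%N f _ cf)) => [n|].
  have [->|g0] := posnP (g n); first by rewrite divn0 big1.
  rewrite (eq_bigr (fun k => (k < f n %/ g n)%N : nat)) => [|k _]; last first.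
    by rewrite leq_divRL.
  have sum_ltn q m : (\sum_(0 <= k < m) (k < q) = minn q m)%N.
    by elim: m => [|m IHm]; rewrite ?big_nil ?big_nat_recr //= ?IHm; lia.
  by rewrite sum_ltn; apply/minn_idPl/leq_div.
have c1 : computable_nat (fun z => g (cfst z)).
  by apply: computable_nat_comp => //;
    apply/computable_nat_fst/computable_nat_id.
apply: computable_bool_and.
  by apply: computable_nat_leq => //; exact: computable_nat_const.
apply: computable_nat_leq; last first.
  by apply: computable_nat_comp => //;
    apply/computable_nat_fst/computable_nat_id.
apply: computable_nat_mul => //.
exact/computable_nat_succ/computable_nat_snd/computable_nat_id.
Qed.

Lemma computable_nat_mod f g : computable_nat f -> computable_nat g ->
  computable_nat (fun n => f n %% g n)%N.
Proof.
move=> cf cg; have := computable_nat_sub _ _ cf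
  (computable_nat_mul _ _ (computable_nat_div _ _ cf cg) cg).
by apply: eq_computable_nat => n; rewrite {1}(divn_eq (f n) (g n)) addKn.
Qed.

Lemma computable_nat_minimize (P : nat -> nat -> bool)
    (exP : forall n, exists v, P n v) :
  computable_bool (fun z => P (cfst z) (csnd z)) ->
  computable_nat (fun n => ex_minn (exP n)).
Proof.
(* [PMin] looks for the first zero, hence the program for the negation of [P]. *)
move=> /computable_bool_neg [c cP]; exists (PMin c) => n /=.
case: ex_minnP => v Pv minv; split.
  by have := cP (cpair n v); rewrite !cpairE Pv.
move=> m mv; exists 0%N; have := cP (cpair n m); rewrite !cpairE.
by case: (boolP (P n m)) => // /minv; rewrite leqNgt mv.
Qed.

(** * An undecidable halting problem *)

(** Follows the syntax of the function and reads the computability of its opaque parts off the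
    context, where facts such as [computable_mstep] are put beforehand. What matches no rule is left
    as a goal. *)
Ltac computability :=
  lazymatch goal with
  | |- computable_nat2_nat _ => unfold computable_nat2_nat; computability
  | |- computable_bool (fun _ => ?k) => exact (computable_nat_const k)
  | |- computable_bool (fun n => leq (@?f n) (@?g n)) =>
      apply (computable_nat_leq f g); computability
  | |- computable_bool (fun n => (@?f n) == (@?g n)) =>
      apply (computable_nat_eq f g); computability
  | |- computable_bool (fun n => andb (@?f n) (@?g n)) =>
      apply (computable_bool_and f g); computability
  | |- computable_bool (fun n => negb (@?f n)) =>
      apply (computable_bool_neg f); computability
  | H : computable_bool ?P |- computable_bool ?P => exact H
  | H : computable_bool ?P |- computable_bool (fun n => ?P (@?g n)) =>
      apply (computable_nat_comp (fun n => nat_of_bool (P n)) g H);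
        computability
  | H : computable_bool (fun z => ?f (cfst z) (csnd z))
    |- computable_bool (fun n => ?f (@?g n) (@?h n)) =>
      apply (computable_nat_comp2 (fun x y => nat_of_bool (f x y)) g h H);
      computability
  | |- computable_nat (fun n => n) => exact computable_nat_id
  | |- computable_nat (fun _ => ?k) => exact (computable_nat_const k)
  | |- computable_nat (fun n => cfst (@?f n)) =>
      apply (computable_nat_fst f); computability
  | |- computable_nat (fun n => csnd (@?f n)) =>
      apply (computable_nat_snd f); computability
  | |- computable_nat (fun n => S (@?f n)) =>
      apply (computable_nat_succ f); computability
  | |- computable_nat (fun n => predn (@?f n)) =>
      apply (computable_nat_pred f); computability
  | |- computable_nat (fun n => cpair (@?f n) (@?g n)) =>
      apply (computable_nat_pair f g); computability
  | |- computable_nat (fun n => addn (@?f n) (@?g n)) =>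
      apply (computable_nat_add f g); computability
  | |- computable_nat (fun n => subn (@?f n) (@?g n)) =>
      apply (computable_nat_sub f g); computability
  | |- computable_nat (fun n => muln (@?f n) (@?g n)) =>
      apply (computable_nat_mul f g); computability
  | |- computable_nat (fun n => divn (@?f n) (@?g n)) =>
      apply (computable_nat_div f g); computability
  | |- computable_nat (fun n => modn (@?f n) (@?g n)) =>
      apply (computable_nat_mod f g); computability
  | |- computable_nat (fun n => expn (@?f n) (@?g n)) =>
      apply (computable_nat_exp f g); computability
  | |- computable_nat (fun n => iter (@?N n) ?f (@?b n)) =>
      apply (computable_nat_iter b N f); computability
  | H : computable_nat ?f |- computable_nat ?f => exact H
  | H : computable_nat ?f |- computable_nat (fun n => ?f (@?g n)) =>
      apply (computable_nat_comp f g H); computability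
  | H : computable_nat2_nat ?f |- computable_nat (fun n => ?f (@?g n) (@?h n))
    =>
      apply (computable_nat_comp2 f g h H); computability
  | |- computable_nat (fun n => nat_of_bool (@?P n)) =>
      change (computable_bool P); computability
  | |- computable_nat cfst => exact (computable_nat_fst _ computable_nat_id)
  | |- computable_nat csnd => exact (computable_nat_snd _ computable_nat_id)
  | |- computable_nat _ =>
      tryif refine (computable_nat_if _ _ _ _ _ _) then computability else idtac
  | |- _ => idtac
  end.

(** * A stack machine that runs coded programs *)

Fixpoint prog_code (c : prog) : nat :=
  match c with
  | PZero => cpair 0 0
  | PSucc => cpair 1 0
  | PFst => cpair 2 0
  | PSnd => cpair 3 0
  | PPair c d => cpair 4 (cpair (prog_code c) (prog_code d))
  | PComp c d => cpair 5 (cpair (prog_code c) (prog_code d))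
  | PRec c d => cpair 6 (cpair (prog_code c) (prog_code d))
  | PMin c => cpair 7 (prog_code c)
  end.

(** The successor keeps the empty stack, coded by 0, apart from every stack with a frame. *)
Definition push (f k : nat) : nat := (cpair f k).+1.

(* A configuration (k, v) consists of a stack k of frames and a register v.
   Frames with tag at most 7 are programs to be run on v; the tags 8 to 11 are
   the pending halves of pairs (8 and 9), recursions and minimizations. The
   configurations with an empty stack are fixed. *)
Definition exec_frame (f k' v : nat) : nat :=
  let t := cfst f in let p := csnd f in
  if t == 0%N then cpair k' 0 else
  if t == 1%N then cpair k' v.+1 else
  if t == 2 then cpair k' (cfst v) else
  if t == 3 then cpair k' (csnd v) else
  if t == 4 then cpair (push (cfst p) (push (cpair 8 (cpair (csnd p) v)) k')) v
    else
  if t == 5 then cpair (push (csnd p) (push (cfst p) k')) v else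
  if t == 6 then
    if csnd v == 0%N then cpair (push (cfst p) k') (cfst v)
    else let w := cpair (cfst v) (csnd v).-1 in
         cpair (push f (push (cpair 10 (cpair (csnd p) w)) k')) w else
  if t == 7 then cpair (push p (push (cpair 11 (cpair p (cpair v 0))) k'))
    (cpair v 0) else
  if t == 8 then cpair (push (cfst p) (push (cpair 9 v) k')) (csnd p) else
  if t == 9 then cpair k' (cpair p v) else
  if t == 10 then
    cpair (push (cfst p) k')
      (cpair (cfst (csnd p)) (cpair (csnd (csnd p)) v)) else
  if v == 0%N then cpair k' (csnd (csnd p))
  else let w := cpair (cfst (csnd p)) (csnd (csnd p)).+1 in
       cpair (push (cfst p) (push (cpair 11 (cpair (cfst p) w)) k')) w.

Definition mstep (z : nat) : nat :=
  if cfst z == 0%N then z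
  else exec_frame (cfst (cfst z).-1) (csnd (cfst z).-1) (csnd z).

Lemma computable_mstep : computable_nat mstep.
Proof. rewrite /mstep /exec_frame /push /=; computability. Qed.

Definition mreach z z' := exists s, iter s mstep z = z'.

Lemma mreach_step z z' : mreach (mstep z) z' -> mreach z z'.
Proof. by move=> [s <-]; exists s.+1; rewrite iterSr. Qed.

Lemma mreach_trans z1 z2 z3 : mreach z1 z2 -> mreach z2 z3 -> mreach z1 z3.
Proof. by move=> [s <-] [t <-]; exists (t + s)%N; rewrite iterD. Qed.

Lemma mreach_refl z : mreach z z.
Proof. by exists 0%N. Qed.

(** The rest k of the stack is arbitrary, so that the induction hypothesis runs a subprogram on top
    of the frame that waits for its result. *)
Lemma eval_mreach c n v k : Defs.eval c n v ->
  mreach (cpair (push (prog_code c) k) n) (cpair k v).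
Proof.
have mstepE f l w : mstep (cpair (push f l) w) = exec_frame f l w.
  by rewrite /mstep /push !cpairE.
elim: c n v k => [||||c IHc d IHd|c IHc d IHd|c IHc d IHd|c IHc] n v k /=;
  rewrite -/cpair.
- by move=> ->; apply: mreach_step; rewrite mstepE /exec_frame !cpairE;
    exact: mreach_refl.
- by move=> ->; apply: mreach_step; rewrite mstepE /exec_frame !cpairE;
    exact: mreach_refl.
- by move=> ->; apply: mreach_step; rewrite mstepE /exec_frame !cpairE;
    exact: mreach_refl.
- by move=> ->; apply: mreach_step; rewrite mstepE /exec_frame !cpairE;
    exact: mreach_refl.
- move=> [a [b [/IHc ca /IHd db ->]]].
  apply: mreach_step; rewrite mstepE /exec_frame !cpairE /=.
  apply: mreach_trans (ca _) _.
  apply: mreach_step; rewrite mstepE /exec_frame !cpairE /=.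
  apply: mreach_trans (db _) _.
  by apply: mreach_step; rewrite mstepE /exec_frame !cpairE; exact: mreach_refl.
- move=> [w /IHd dw /IHc cv].
  apply: mreach_step; rewrite mstepE /exec_frame !cpairE /=.
  exact: mreach_trans (dw _) (cv _).
- have := cpair_cfst_csnd n; move: (cfst n) (csnd n) => x m <- {n}.
  elim: m v k => [|m IHm] v k.
    move=> /IHc cv.
    by apply: mreach_step; rewrite mstepE /exec_frame !cpairE /=; exact: cv.
  move=> [u /IHm mu /IHd dv].
  apply: mreach_step; rewrite mstepE /exec_frame !cpairE /=.
  apply: mreach_trans (mu _) _.
  by apply: mreach_step; rewrite mstepE /exec_frame !cpairE /=; exact: dv.
- move=> [/IHc cv0 cvm].
  apply: mreach_step; rewrite mstepE /exec_frame !cpairE /=.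
  (* The minimization loop, entered at any candidate m; induction on the number u of candidates
     still to be rejected before v. *)
  suff from m u : (m + u = v)%N ->
      mreach (cpair (push (prog_code c)
                (push (cpair 11 (cpair (prog_code c) (cpair n m))) k))
                  (cpair n m))
        (cpair k v) by exact: from.
  elim: u m => [|u IHu] m muv.
    rewrite addn0 in muv; rewrite {m}muv.
    apply: mreach_trans (cv0 _) _.
    by apply: mreach_step; rewrite mstepE /exec_frame !cpairE /=;
      exact: mreach_refl.
  have [|w /IHc cm] := cvm m; first by lia.
  apply: mreach_trans (cm _) _.
  apply: mreach_step; rewrite mstepE /exec_frame !cpairE /=.
  by apply: IHu; lia.
Qed.

(* [halts i s]: the program coded by i, run on its own code, has halted with
   output 0 after s steps. *)
Definition halts (i s : nat) : bool :=
  let z := iter s mstep (cpair (push i 0) i) in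
  (cfst z == 0%N) && (csnd z == 0%N).

Lemma computable_halts : computable_bool (fun z => halts (cfst z) (csnd z)).
Proof. have cm := computable_mstep; rewrite /halts /push /=; computability. Qed.

Lemma mstep_halted z : cfst z = 0%N -> mstep z = z.
Proof. by rewrite /mstep => ->. Qed.

Lemma iter_mstep_halted z s : cfst z = 0%N -> iter s mstep z = z.
Proof. by move=> z0; elim: s => //= s ->; exact: mstep_halted. Qed.

Lemma halts0 i : halts i 0 = false.
Proof. by rewrite /halts /= !cpairE. Qed.

Lemma halts_mono i s t : (s <= t)%N -> halts i s -> halts i t.
Proof.
move=> /subnK <-; rewrite /halts iterD => /andP[/eqP h0 h1].
by rewrite iter_mstep_halted // h0 eqxx.
Qed.

(* A decision procedure would be a program which, run on its own code, halts
   with output 0 exactly when it does not; the machine being deterministic, only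
   its completeness for [eval] is needed. *)
Lemma halts_undecidable (D : nat -> nat) : computable_nat D ->
  ~ (forall i, (exists s, halts i s) <-> D i <> 0%N).
Proof.
move=> [c cD] decD; set i := prog_code c.
have /= [s runD] := eval_mreach _ _ _ 0%N (cD i).
have stop t : (s <= t)%N ->
    iter t mstep (cpair (push i 0) i) = cpair 0 (D i).
  by move=> /subnK <-; rewrite iterD runD iter_mstep_halted ?cpairE.
case: (D i =P 0%N) => Di.
  have /decD [] : exists s, halts i s; last by [].
  by exists s; rewrite /halts runD !cpairE Di.
have /decD [t ht] := Di.
have := halts_mono _ _ _ (leq_maxr s t) ht.
by rewrite /halts stop ?leq_maxl // !cpairE => /andP[_ /eqP].
Qed.

(** * Computable sequences of rationals *)

Lemma eq_computable_rat_seq (a b : nat -> rat) :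
  a =1 b -> computable_rat_seq a -> computable_rat_seq b.
Proof. by move=> ab [g cg ag]; exists g => // n; rewrite -ab. Qed.

Lemma computable_rat_code g :
  computable_nat g -> computable_rat_seq (fun n => rat_of_code (g n)).
Proof. by exists g. Qed.

Lemma computable_rat_comp a g : computable_rat_seq a -> computable_nat g ->
  computable_rat_seq (fun n => a (g n)).
Proof. by move=> [h ch ah] cg; exists (fun n => h (g n)) => //;
  computability. Qed.

Lemma computable_rat_nat_comp r a : computable_rat_nat r ->
  computable_rat_seq a -> computable_nat (fun n => r (a n)).
Proof.
move=> cr [g cg ag]; apply: eq_computable_nat (computable_nat_comp _ _ cr cg).
by move=> n; rewrite ag.
Qed.

Lemma computable_rat_ratio f g : computable_nat f -> computable_nat g ->
  computable_rat_seq (fun n => (f n)%:R / (g n).+1%:R).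
Proof.
move=> cf cg; exists (fun n => cpair (cpair (f n) 0) (g n));
  first computability.
by move=> n; rewrite /rat_of_code !cpairE subr0.
Qed.

Lemma computable_rat_of_nat f :
  computable_nat f -> computable_rat_seq (fun n => (f n)%:R).
Proof.
move=> cf; apply: eq_computable_rat_seq
  (computable_rat_ratio f (fun=> 0%N) cf (computable_nat_const 0)) => n.
by rewrite divr1.
Qed.

Lemma computable_rat_half_exp f :
  computable_nat f -> computable_rat_seq (fun n => 2^-1 ^+ f n).
Proof.
move=> cf; apply: eq_computable_rat_seq
  (computable_rat_ratio (fun=> 1%N) (fun n => (2 ^ f n).-1) _ _).
- by move=> n; rewrite prednK ?expn_gt0 // natrX exprVn mul1r.
- by computability.
- by computability.
Qed.

Lemma computable_rat_opp a :
  computable_rat_seq a -> computable_rat_seq (fun n => - a n).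
Proof.
move=> [g cg ag].
exists (fun n => cpair (cpair (csnd (cfst (g n))) (cfst (cfst (g n))))
  (csnd (g n))).
  by computability.
by move=> n; rewrite ag /rat_of_code !cpairE -mulNr opprB.
Qed.

Lemma computable_rat_add a b : computable_rat_seq a -> computable_rat_seq b ->
  computable_rat_seq (fun n => a n + b n).
Proof.
move=> [g cg ag] [h ch bh].
exists (fun n => cpair
  (cpair (cfst (cfst (g n)) * (csnd (h n)).+1 + cfst (cfst (h n)) *
    (csnd (g n)).+1)
         (csnd (cfst (g n)) * (csnd (h n)).+1 + csnd (cfst (h n)) *
           (csnd (g n)).+1))
  ((csnd (g n)).+1 * (csnd (h n)).+1).-1)%N; first computability.
move=> n; rewrite ag bh /rat_of_code !cpairE prednK // !natrD !natrM.
have dg : (csnd (g n)).+1%:R != 0 :> rat by rewrite pnatr_eq0.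
have dh : (csnd (h n)).+1%:R != 0 :> rat by rewrite pnatr_eq0.
move: (csnd (g n)).+1%:R (csnd (h n)).+1%:R dg dh => x y x0 y0.
by field; rewrite x0 y0.
Qed.

Lemma computable_rat_mul a b : computable_rat_seq a -> computable_rat_seq b ->
  computable_rat_seq (fun n => a n * b n).
Proof.
move=> [g cg ag] [h ch bh].
exists (fun n => cpair
  (cpair (cfst (cfst (g n)) * cfst (cfst (h n)) + csnd (cfst (g n)) * csnd
    (cfst (h n)))
         (cfst (cfst (g n)) * csnd (cfst (h n)) + csnd (cfst (g n)) * cfst
           (cfst (h n))))
  ((csnd (g n)).+1 * (csnd (h n)).+1).-1)%N; first computability.
move=> n; rewrite ag bh /rat_of_code !cpairE prednK // !natrD !natrM.
have dg : (csnd (g n)).+1%:R != 0 :> rat by rewrite pnatr_eq0.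
have dh : (csnd (h n)).+1%:R != 0 :> rat by rewrite pnatr_eq0.
move: (csnd (g n)).+1%:R (csnd (h n)).+1%:R dg dh => x y x0 y0.
by field; rewrite x0 y0.
Qed.

Lemma computable_rat_le a b : computable_rat_seq a -> computable_rat_seq b ->
  computable_bool (fun n => a n <= b n).
Proof.
move=> [g cg ag] [h ch bh].
apply: (@eq_computable_nat (fun n => nat_of_bool
  (cfst (cfst (g n)) * (csnd (h n)).+1 + csnd (cfst (h n)) * (csnd (g n)).+1 <=
   cfst (cfst (h n)) * (csnd (g n)).+1 + csnd (cfst (g n)) *
     (csnd (h n)).+1)%N)).
  move=> n; rewrite ag bh /rat_of_code; congr nat_of_bool.
  rewrite ler_pdivrMr ?ltr0n // mulrAC ler_pdivlMr ?ltr0n // !mulrBl.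
  by rewrite lerBlDr addrAC lerBrDr -!natrM -!natrD ler_nat.
by computability.
Qed.

Lemma computable_rat_if P a b : computable_bool P ->
  computable_rat_seq a -> computable_rat_seq b ->
  computable_rat_seq (fun n => if P n then a n else b n).
Proof.
move=> cP [g cg ag] [h ch bh]; exists (fun n => if P n then g n else h n).
  by computability.
by move=> n; case: (P n).
Qed.

Lemma computable_rat_max a b : computable_rat_seq a -> computable_rat_seq b ->
  computable_rat_seq (fun n => Num.max (a n) (b n)).
Proof.
move=> ca cb; apply: eq_computable_rat_seq
  (computable_rat_if _ _ _ (computable_rat_le _ _ ca cb) cb ca) => n.
by case: leP.
Qed.

Lemma computable_rat_min a b : computable_rat_seq a -> computable_rat_seq b ->
  computable_rat_seq (fun n => Num.min (a n) (b n)).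
Proof.
move=> ca cb; apply: eq_computable_rat_seq
  (computable_rat_if _ _ _ (computable_rat_le _ _ ca cb) ca cb) => n.
by case: leP.
Qed.

Lemma computable_rat_sum (F : nat -> nat -> rat) N :
  computable_rat_seq (fun z => F (cfst z) (csnd z)) -> computable_nat N ->
  computable_rat_seq (fun n => \sum_(0 <= k < N n) F n k).
Proof.
move=> cF cN.
(* The recursion has to run on codes, so addition of rationals is first made a computable function
   of two codes. *)
have [add cadd addE] : exists2 add, computable_nat2_nat add &
    forall x y, rat_of_code (add x y) = rat_of_code x + rat_of_code y.
  have [| |g cg gE] := computable_rat_add (fun z => rat_of_code (cfst z))
    (fun z => rat_of_code (csnd z)).
  - by apply: computable_rat_code; computability.
  - by apply: computable_rat_code; computability.
  exists (fun x y => g (cpair x y)); first computability.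
  by move=> x y; rewrite -gE !cpairE.
have [g cg FE] := cF.
exists (fun n => nat_rect (fun=> nat) 0%N (fun k h => add h (g (cpair n k)))
  (N n)).
  by apply: (computable_nat_rec (fun=> 0%N) N
    (fun n k h => add h (g (cpair n k))));
    computability.
move=> n; elim: (N n) => [|k IHk] /=.
  by rewrite big_nil /rat_of_code -(cpair_cfst_csnd 0) (_ : cpair 0 0 = 0%N) //
    !cpairE subrr mul0r.
by rewrite big_nat_recr //= addE -IHk -FE !cpairE.
Qed.

Lemma computable_simple_terms (N : nat -> nat) (c a b : nat -> nat -> rat) :
  computable_nat N ->
  computable_rat_seq (fun z => c (cfst z) (csnd z)) ->
  computable_rat_seq (fun z => a (cfst z) (csnd z)) ->
  computable_rat_seq (fun z => b (cfst z) (csnd z)) ->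
  exists2 s, computable_nat s & forall n,
    simple_terms (s n) = [seq (c n m, (a n m, b n m)) | m <- iota 0 (N n)].
Proof.
move=> cN [gc cgc cE] [ga cga aE] [gb cgb bE].
pose t n m := let z := cpair n m in cpair (gc z) (cpair (ga z) (gb z)).
(* The first term is outermost in the code, so the list is built from its end: step k prepends the
   term of index N n - (k + 1). *)
pose enc n k := nat_rect (fun=> nat) 0%N
  (fun k h => cpair (t n (N n - k.+1)%N) h) k.
exists (fun n => cpair (N n) (enc n (N n))).
  apply: computable_nat_pair => //.
  apply: (computable_nat_rec (fun=> 0%N) N
    (fun n k h => cpair (t n (N n - k.+1)%N) h)) => //; rewrite /t /=;
      computability.
move=> n; rewrite /simple_terms !cpairE; apply/eq_in_map => m.
rewrite mem_iota add0n => /= mN.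
have -> : iter m csnd (enc n (N n)) = enc n (N n - m)%N.
  elim: m mN => [|m IHm] mN; first by rewrite subn0.
  rewrite iterS IHm; last exact: ltnW.
  by rewrite -(ltn_predK mN) subSS subSn /= ?cpairE //; lia.
have -> : (N n - m = (N n - m.+1).+1)%N by lia.
rewrite /= (_ : (N n - _)%N = m); last by lia.
by rewrite /t !cpairE -cE -aE -bE !cpairE.
Qed.

(** The basic modulus: its successor exceeds 1 / eps. On codes it is a single division of naturals;
    for eps <= 0, truncated subtraction and division by zero give the value 0 on both sides. *)
Definition inv_trunc (eps : rat) : nat := Num.truncn eps^-1.

Lemma computable_inv_trunc : computable_rat_nat inv_trunc.
Proof.
apply: (@eq_computable_nat (fun n =>
  (csnd n).+1 %/ (cfst (cfst n) - csnd (cfst n)))%N); last by computability.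
move=> n; rewrite /inv_trunc /rat_of_code invf_div.
set p := cfst _; set q := csnd (cfst _); set d := csnd n.
have d0 : 0 < d.+1%:R :> rat by rewrite ltr0n.
apply/esym; have [pq|qp] := leqP p q.
  rewrite (eqP pq) divn0; apply/eqP; rewrite -leqn0 truncn_le_nat.
  apply: le_lt_trans ltr01; rewrite pmulr_rle0 // invr_le0 subr_le0.
  by rewrite ler_nat.
rewrite -natrB ?(ltnW qp) //; apply: truncn_def.
have r0 : 0 < (p - q)%:R :> rat by rewrite ltr0n subn_gt0.
rewrite ler_pdivlMr // ltr_pdivrMr // -!natrM ler_nat ltr_nat leq_trunc_div.
by rewrite ltn_ceil // subn_gt0.
Qed.

Lemma inv_trunc_lt eps : 0 < eps -> (inv_trunc eps).+1%:R^-1 < eps.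
Proof.
move=> e0; rewrite invf_plt ?posrE ?ltr0n //; exact: truncnS_gt.
Qed.

(** * Rotations of cells *)

Section rotations.
Context {R : realType}.
Implicit Types (x : R) (d : nat -> R) (i j n : nat) (B : set R).
Local Notation mu := (@lebesgue_measure R).

Definition left_end i : R := 1 - 2^-1 ^+ i.
Definition len i : R := 2^-1 ^+ i.+1.
Definition cell i : set R := [set x | left_end i <= x < left_end i.+1].

Lemma len_gt0 i : 0 < len i.
Proof. by rewrite exprn_gt0 // invr_gt0. Qed.

Lemma left_endS i : left_end i.+1 = left_end i + len i.
Proof. by rewrite /left_end /len exprS; lra. Qed.

Lemma len_left_end i : left_end i = 1 - 2 * len i.
Proof. by rewrite /left_end /len exprS; lra. Qed.

Lemma len_le_half i : len i <= 2^-1.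
Proof.
rewrite /len exprS ler_piMr ?invr_ge0 //.
by apply: exprn_ile1; rewrite ?invr_ge0 // invf_le1 ?ler1n.
Qed.

Lemma left_end_ge0 i : 0 <= left_end i.
Proof. by rewrite len_left_end; have := len_le_half i; lra. Qed.

Lemma left_end_lt1 i : left_end i < 1.
Proof. by rewrite len_left_end; have := len_gt0 i; lra. Qed.

Lemma left_end_le i j : (i <= j)%N -> left_end i <= left_end j.
Proof.
move=> /subnK <-; elim: (j - i)%N => [|k IHk]; first by rewrite add0n.
by rewrite addSn left_endS (le_trans IHk) // lerDl ltW // len_gt0.
Qed.

Lemma left_end0 : left_end 0 = 0.
Proof. by rewrite /left_end expr0 subrr. Qed.

Lemma cell_inj i j x : cell i x -> cell j x -> i = j.
Proof.
move=> /= /andP[ix xi] /andP[jx xj].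
by case: (ltngtP i j) => // /left_end_le h; exfalso; lra.
Qed.

Lemma half_exp_lt (e : R) : 0 < e -> exists n, 2^-1 ^+ n < e.
Proof.
move=> e0; exists (Num.truncn e^-1); rewrite exprVn invf_plt ?posrE ?exprn_gt0
  //.
apply: lt_le_trans (truncnS_gt _) _; rewrite -natrX ler_nat.
exact: ltn_expl.
Qed.

Lemma cell_cover x : 0 <= x < 1 -> exists i, cell i x.
Proof.
move=> /andP[x0 x1]; have [n hn] : exists n, 2^-1 ^+ n < 1 - x.
  by apply: half_exp_lt; lra.
have exn : exists n, x < left_end n by exists n; rewrite /left_end; lra.
case: (ex_minnP exn) => [[|i]]; first by rewrite left_end0; lra.
move=> xi min; exists i; rewrite /cell /= xi andbT leNgt; apply/negP => /min.
by rewrite ltnn.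
Qed.

Lemma cell_sub i x : cell i x -> 0 <= x < 1.
Proof.
move=> /= /andP[ix xi]; have := left_end_ge0 i; have := left_end_lt1 i.+1; lra.
Qed.

Lemma cell_bigcup : [set x | 0 <= x < 1] = \bigcup_i cell i.
Proof.
apply/seteqP; split => x /=; first by move=> /cell_cover[i ?]; exists i.
by move=> [i _ /cell_sub].
Qed.

Lemma trivIset_cell (F : nat -> set R) :
  (forall i, F i `<=` cell i) -> trivIset setT F.
Proof.
by move=> Fcell i j _ _ [x [/Fcell ix /Fcell jx]]; exact: cell_inj ix jx.
Qed.

Lemma cellE i : cell i = `[left_end i, left_end i.+1[%classic.
Proof. by apply/seteqP; split => x /=; rewrite in_itv. Qed.

Lemma measurable_cell i : measurable (cell i).
Proof. by rewrite cellE. Qed.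

Definition rotation (c : R) i x : R :=
  if x + c < left_end i.+1 then x + c else x + c - len i.

Definition cell_index x : nat := xget 0%N [set i | cell i x].

(** The point 1 of the unit interval lies in no cell and is fixed. *)
Definition cell_rot d x : R :=
  if 0 <= x < 1 then rotation (d (cell_index x)) (cell_index x) x else x.

Lemma cell_rotE d i x : cell i x -> cell_rot d x = rotation (d i) i x.
Proof.
move=> ix; rewrite /cell_rot (cell_sub _ _ ix).
have -> // : cell_index x = i.
apply: (cell_inj _ _ x) => //.
by apply: (@xgetPex _ 0%N [set i | cell i x]); exists i.
Qed.

Definition is_shift d := forall i, 0 <= d i <= len i.

Lemma rotation_cell (c : R) i x : 0 <= c <= len i -> cell i x -> cell i
  (rotation c i x).
Proof.
rewrite /cell /= /rotation left_endS => /andP[c0 ci] /andP[ix xi].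
by case: ltP => xc; apply/andP; split; lra.
Qed.

Lemma cell_rot_cell d i x : is_shift d -> cell i x -> cell i (cell_rot d x).
Proof. by move=> sd ix; rewrite (cell_rotE _ i) //; exact: rotation_cell. Qed.

Lemma measurable_rotation c i : measurable_fun setT (rotation c i).
Proof.
apply: measurable_fun_ifT => //=.
  by apply: measurable_fun_ltr => //; exact: measurable_funD.
- exact: measurable_funD.
- by apply: measurable_funB => //; exact: measurable_funD.
Qed.

Lemma measurable_cell_rot d : measurable_fun setT (cell_rot d).
Proof.
have mcup : measurable (\bigcup_i cell i).
  by apply: bigcupT_measurable => i; exact: measurable_cell.
have -> : setT = \bigcup_i cell i `|` ~` \bigcup_i cell i by rewrite setUv.
apply/measurable_funU => //; first exact: measurableC.
split.
  apply/measurable_fun_bigcup => [i|i]; first exact: measurable_cell.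
  apply: (eq_measurable_fun (rotation (d i) i)).
    by move=> x /set_mem ix; rewrite (cell_rotE _ i).
  exact: measurable_funS (measurable_rotation _ _).
apply: (eq_measurable_fun id) => [x /set_mem|]; last exact: measurable_id.
by rewrite -cell_bigcup /cell_rot /= => /negP/negbTE ->.
Qed.

(** The pushforward under the translation agrees with Lebesgue measure on half-open intervals, and
    these values determine the measure. *)
Lemma lebesgue_measure_translation (c : R) B : measurable B ->
  mu ((fun x => x + c) @^-1` B) = mu B.
Proof.
move=> mB.
rewrite -[LHS]/(pushforward mu (fun x : R => x + c : measurableTypeR R) B).
apply/esym/lebesgue_measure_unique => //=.
  exact: measurable_funD.
move=> _ _ [[a b]] /= _ <-; rewrite /pushforward.
have -> : (fun x => x + c) @^-1` [set` `]a, b]] = [set` `]a - c, b - c]] :> set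
  R.
  apply/seteqP; split => x /=; rewrite !in_itv /=; lra.
rewrite !lebesgue_measure_itv /= !lte_fin ltrD2r -!EFinB.
by case: ifP => // _; congr (_%:E); ring.
Qed.

Lemma mu_cell_sum B : measurable B ->
  mu ([set x | 0 <= x < 1] `&` B) = (\sum_(0 <= i <oo) mu (cell i `&` B))%E.
Proof.
move=> mB; rewrite cell_bigcup setI_bigcupl measure_semi_bigcup //.
- by move=> i; apply: measurableI => //; exact: measurable_cell.
- by apply: trivIset_cell => i x [].
- by apply: bigcupT_measurable => i; apply: measurableI => //;
    exact: measurable_cell.
Qed.

(** A rotation is a translation on each of two arcs, so the preimage is a disjoint union of two
    translated pieces. *)
Lemma mu_rotation (c : R) i B : 0 <= c <= len i -> measurable B ->
  mu (cell i `&` rotation c i @^-1` B) = mu (cell i `&` B).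
Proof.
move=> ci mB; set l := left_end i.
have mtr (a b : R) : measurable ([set x : R | a <= x < b]).
  by rewrite (_ : [set x | _] = `[a, b[%classic) //; apply/seteqP;
    split => x /=;
    rewrite in_itv.
have mpre (e : R) C : measurable C -> measurable ((fun x : R => x + e) @^-1` C).
  move=> mC; rewrite -[_ @^-1` _]setTI.
  by have /(_ measurableT _ mC) : measurable_fun setT (fun x : R => x + e)
    by exact: measurable_funD.
have -> : cell i `&` rotation c i @^-1` B =
    (fun x => x + c) @^-1` ([set x | l + c <= x < l + len i] `&` B) `|`
    (fun x => x + (c - len i)) @^-1` ([set x | l <= x < l + c] `&` B).
  apply/seteqP; split => x; rewrite /cell /= /rotation left_endS -/l.
    case: ifPn; rewrite -?leNgt => xc [ix Bx]; [left|right].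
      by split => //; lra.
    by rewrite addrA; split => //; lra.
  case=> [][ix Bx]; rewrite -/l.
    by rewrite (_ : (x + c < l + len i) = true); [split => //; lra | lra].
  have -> : (x + c < l + len i) = false by apply/negbTE; rewrite -leNgt; lra.
  by move: Bx; rewrite addrA => Bx; split => //; lra.
have -> : cell i `&` B = ([set x | l + c <= x < l + len i] `&` B) `|`
   ([set x | l <= x < l + c] `&` B).
  rewrite -setIUl; congr (_ `&` _); apply/seteqP; split => x;
    rewrite /cell /= left_endS -/l; last lra.
  by case: (ltP x (l + c)) => ? ?; [right|left]; lra.
rewrite !measureU; first last.
- by apply/seteqP; split => x //= [[? _] [? _]]; lra.
- by apply: mpre; apply: measurableI.
- by apply: mpre; apply: measurableI.
- by apply/seteqP; split => x //= [[? _] [? _]]; lra.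
- by apply: measurableI => //; exact: mtr.
- by apply: measurableI => //; exact: mtr.
by congr (_ + _)%E; apply: lebesgue_measure_translation;
  apply: measurableI => //; exact: mtr.
Qed.

(** The cells leave out only the null point 1. *)
Lemma mu_I01 B : measurable B ->
  mu (@I01 R `&` B) = mu ([set x | 0 <= x < 1] `&` B).
Proof.
move=> mB; have mI : measurable [set x : R | 0 <= x < 1].
  by rewrite cell_bigcup; apply: bigcupT_measurable => i;
    exact: measurable_cell.
have mI01 : measurable (@I01 R) by exact: measurable_itv.
apply/eqP; rewrite eq_le; apply/andP; split; last first.
  apply: le_measure; rewrite ?inE; [exact: measurableI| exact: measurableI|].
  by move=> x [/= ? ?]; split => //; rewrite /I01 /= in_itv /=; lra.
have -> : mu ([set x | 0 <= x < 1] `&` B) =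
    (mu ([set x | (0 <= x < 1)%R] `&` B) + mu [set 1%R])%E.
  by rewrite lebesgue_measure_set1 adde0.
apply: le_trans (measureU2 _ _ _) => //; last exact: measurableI.
apply: le_measure; rewrite ?inE; first exact: measurableI.
  by apply: measurableU => //; exact: measurableI.
move=> x [/=]; rewrite /I01 /= in_itv /= => x01 Bx.
by case: (ltP x 1) => x1; [left; split => //=|right => /=]; lra.
Qed.

Lemma measure_preserving_cell_rot d : is_shift d -> measure_preserving01
  (cell_rot d).
Proof.
move=> sd; split.
- exact: measurable_funS (measurable_cell_rot d).
- move=> x; rewrite /I01 /= !in_itv /= => /andP[x0 x1].
  rewrite /cell_rot; case: ifPn => [/cell_cover[i ix]|_]; last by rewrite x0.
  have := cell_rot_cell _ _ _ sd ix; rewrite (cell_rotE _ i) //.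
  have -> : cell_index x = i.
    apply: (cell_inj _ _ x) => //.
    by apply: (@xgetPex _ 0%N [set i | cell i x]); exists i.
  by move=> /cell_sub; lra.
- move=> B mB BI; have mpre : measurable (cell_rot d @^-1` B).
    by rewrite -[_ @^-1` _]setTI; exact: measurable_cell_rot.
  rewrite -[in RHS](setIidr BI) !mu_I01 // !mu_cell_sum //.
  apply: eq_eseriesr => i _; rewrite -[RHS](mu_rotation (d i)) //.
  congr (mu _); apply/seteqP; split => x /= [ix];
    by rewrite (cell_rotE _ i).
Qed.

End rotations.

(** * Bounds on Lp norms *)

Section Lp_norms.
Context {R : realType}.
Implicit Types (f g : R -> R) (D E N : set R) (p M e d eps c m : R).
Local Notation mu := (@lebesgue_measure R).

Lemma measurable_I01 : measurable (@I01 R).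
Proof. exact: measurable_itv. Qed.

Lemma mu_I01_1 : mu (@I01 R) = 1%E.
Proof. by rewrite /I01 lebesgue_measure_itv /= lte_fin ltr01 sube0. Qed.

Lemma measurable_powR_norm (p : R) f : measurable_fun setT f ->
  measurable_fun setT (fun x => (`|f x| `^ p)%:E).
Proof.
move=> mf; apply/measurable_EFinP.
apply: (@measurableT_comp _ _ _ _ _ _ (@powR R ^~ p)) => //.
exact: measurableT_comp.
Qed.

Lemma le_powR (p a b : R) : 0 <= p -> 0 <= a -> a <= b -> a `^ p <= b `^ p.
Proof.
by move=> p0 a0 ab; apply: ge0_ler_powR; rewrite ?nnegrE // (le_trans a0).
Qed.

Lemma Lp_normE (p : R) f : 0 < p ->
  Lp_norm p f = ((\int[mu]_(x in @I01 R) (`|f x| `^ p)%:E) `^ p^-1)%E.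
Proof.
move=> p0; rewrite integral_mkcond /Lp_norm unlock.
congr (@poweR _ _ _); apply: eq_integral => x _ /=.
rewrite /patch; case: ifP => // _.
by rewrite normr0 powR0 // gt_eqF.
Qed.

(** The form of the norm estimates below: a crude bound M on a set D of small measure, a small bound
    e off D, and a null set N to absorb the rational points. The integrand is compared with M^p
    times the indicator of D, plus e^p. *)
Lemma integral_I01_le (p : R) f N D M e : 0 < p -> measurable_fun setT f ->
  mu.-negligible N -> measurable D -> 0 <= M -> 0 <= e ->
  (forall x, I01 x -> ~ N x -> D x -> `|f x| <= M) ->
  (forall x, I01 x -> ~ N x -> ~ D x -> `|f x| <= e) ->
  (\int[mu]_(x in @I01 R) ((`|f x| `^ p)%R)%:E <= (M `^ p)%:E * mu D +
    (e `^ p)%:E)%E.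
Proof.
move=> p0 mf [N' [mN' N'0 NN']] mD M0 e0 fM fe.
pose g x : R := M `^ p * \1_D x + e `^ p.
have mg : measurable_fun setT (EFin \o g).
  apply/measurable_EFinP; apply: measurable_funD => //.
  by apply: measurable_funM => //; exact: measurable_indic.
have : (\int[mu]_(x in @I01 R) (`|f x| `^ p)%:E <= \int[mu]_(x in @I01 R)
  (g x)%:E)%E.
  apply: ae_ge0_le_integral => //.
  - exact: measurable_I01.
  - exact: measurable_funS (measurable_powR_norm p f mf).
  - by move=> x _; rewrite lee_fin /g addr_ge0 ?mulr_ge0 ?powR_ge0.
  - exact: measurable_funS mg.
  exists N'; split => // x /= /not_implyP[Ix /negP hx]; apply: contrapT => nNx.
  apply: (negP hx); have nN : ~ N x by move=> /NN'.
  rewrite lee_fin /g indicE; have [xD|xD] := boolP (x \in D).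
    rewrite mulr1; apply: (@le_trans _ _ (M `^ p));
      last by rewrite lerDl powR_ge0.
    by apply: le_powR; rewrite ?(ltW p0) //; apply: fM => //; apply/set_mem.
  rewrite mulr0 add0r; apply: le_powR; rewrite ?(ltW p0) //.
  by apply: fe => //; move/negP: xD; apply: contra_not => /mem_set.
move=> /le_trans; apply.
have mI := measurable_I01.
rewrite /g; under eq_integral do rewrite EFinD EFinM.
rewrite ge0_integralD //=; first last.
- by move=> x _; rewrite lee_fin powR_ge0.
- by apply/measurable_EFinP; apply: measurable_funM.
- by move=> x _; rewrite lee_fin mulr_ge0 ?powR_ge0.
rewrite ge0_integralZl_EFin ?powR_ge0 //; last first.
  by apply/measurable_EFinP; exact: measurable_indic.
rewrite integral_indic // integral_cst // [X in (_ + _ * X)%E]mu_I01_1 mule1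
  leeD2r //.
apply: lee_wpmul2l; first by rewrite lee_fin powR_ge0.
by apply: le_measure; rewrite ?inE //; exact: measurableI.
Qed.

Lemma lt_Lp_norm (p : R) f N D M e d eps : 0 < p -> measurable_fun setT f ->
  mu.-negligible N -> measurable D -> (mu D <= d%:E)%E -> 0 <= M -> 0 <= e ->
  0 < eps ->
  (forall x, I01 x -> ~ N x -> D x -> `|f x| <= M) ->
  (forall x, I01 x -> ~ N x -> ~ D x -> `|f x| <= e) ->
  M `^ p * d + e `^ p < eps `^ p ->
  (Lp_norm p f < eps%:E)%E.
Proof.
move=> p0 mf nN mD muD M0 e0 eps0 fM fe lt.
rewrite Lp_normE //.
have := integral_I01_le p f N D M e p0 mf nN mD M0 e0 fM fe.
have : (0 <= \int[mu]_(x in @I01 R) (`|f x| `^ p)%:E)%E.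
  by apply: integral_ge0 => x _; rewrite lee_fin powR_ge0.
have : ((M `^ p)%:E * mu D + (e `^ p)%:E <= (M `^ p * d + e `^ p)%:E)%E.
  by rewrite EFinD leeD2r // EFinM lee_pmul // lee_fin powR_ge0.
move: (\int[mu]_(x in _) _)%E => I h1 I0 /le_trans /(_ h1) Ile.
have If : I \is a fin_num by rewrite ge0_fin_numE // (le_lt_trans Ile) // ltry.
rewrite -(fineK If) poweR_EFin lte_fin.
rewrite -[ltRHS](powRr1 (ltW eps0)) -[in ltRHS](@divff _ p) ?gt_eqF // powRrM.
apply: gt0_ltr_powR; rewrite ?invr_gt0 ?nnegrE ?powR_ge0 ?fine_ge0 //.
by apply: le_lt_trans lt; rewrite -lee_fin fineK.
Qed.

(** The natural lower bound is c m^(1/p); since m <= 1 <= p it is at least c m, which no longer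
    depends on p and so serves L1 and L2 alike. *)
Lemma ge_Lp_norm (p : R) f E c m : 1 <= p -> measurable_fun setT f ->
  measurable E -> E `<=` @I01 R -> mu E = m%:E -> m <= 1 -> 0 <= c ->
  (forall x, E x -> c <= `|f x|) -> ((c * m)%:E <= Lp_norm p f)%E.
Proof.
move=> p1 mf mE EI muE m1 c0 fc.
have p0 : 0 < p by lra.
have m0 : 0 <= m by rewrite -lee_fin -muE.
rewrite Lp_normE //.
apply: (@le_trans _ _ (((c * m) `^ p)%:E `^ p^-1)%E).
  rewrite poweR_EFin -powRrM divff ?gt_eqF // powRr1 //; exact: mulr_ge0.
apply: gt0_ler_poweR; first by rewrite invr_ge0 ltW.
- by rewrite in_itv /= lee_fin powR_ge0 leey.
- rewrite in_itv /= leey andbT; apply: integral_ge0 => x _.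
  by rewrite lee_fin powR_ge0.
apply: (@le_trans _ _ (\int[mu]_(x in E) (`|f x| `^ p)%:E)%E); last first.
  apply: ge0_subset_integral => //; first exact: measurable_I01.
  exact: measurable_funS (measurable_powR_norm p f mf).
apply: (@le_trans _ _ (\int[mu]_(x in E) (c `^ p)%:E)%E); last first.
  apply: ge0_le_integral => //.
  - by move=> x _; rewrite lee_fin powR_ge0.
  - exact: measurable_funS (measurable_powR_norm p f mf).
  - move=> x Ex; rewrite lee_fin; apply: le_powR; rewrite ?(ltW p0) //.
    exact: fc.
rewrite integral_cst // [X in (_ * X)%E]muE -EFinM lee_fin powRM //.
rewrite ler_wpM2l ?powR_ge0 //.
have [->|mn0] := eqVneq m 0; first by rewrite powR0 // gt_eqF.
by apply: ge1r_powR => //; rewrite lt_neqAle eq_sym mn0 m0.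
Qed.

Lemma bounded_in_Lp (p : R) f M : 0 < p -> measurable_fun setT f ->
  (forall x, I01 x -> `|f x| <= M) -> in_Lp p f.
Proof.
move=> p0 mf fM; have M0 : 0 <= M.
  by apply: le_trans (fM 0 _) => //; rewrite /I01 /= in_itv /= lexx ler01.
rewrite /in_Lp; apply/andP; split.
  apply/mem_set.
  apply: (proj1 (@measurable_restrictT _ _ _ _ _ f measurable_I01)).
  exact: measurable_funS mf.
apply/mem_set; rewrite /= /finite_norm.
apply: (@lt_trans _ _ (M + 1)%:E); last exact: ltry.
apply: (lt_Lp_norm p f set0 set0 0 M 0) => //.
- exact: negligible_set0.
- by rewrite measure0.
- by rewrite ltr_wpDl.
- by move=> x Ix _ _; exact: fM.
- by rewrite mulr0 add0r gt0_ltr_powR // ?nnegrE ?addr_ge0 // ltrDl.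
Qed.

Lemma cvg_LpP (p : R) (u : nat -> R -> R) f :
  (forall eps : R, 0 < eps -> exists n0, forall n, (n0 <= n)%N ->
     (Lp_norm p (u n \- f)%R < eps%:E)%E) -> cvg_Lp p u f.
Proof.
move=> h; apply/fine_cvgP; split.
  have [n0 hn] := h 1 ltr01; exists n0 => // n /hn lt1.
  by rewrite ge0_fin_numE ?Lnorm_ge0 // (lt_trans lt1) // ltry.
apply/cvgr0Pnorm_lt => e /h[n0 hn]; exists n0 => // n /hn lte.
have N0 : (0 <= Lp_norm p (u n \- f)%R)%E by exact: Lnorm_ge0.
rewrite /= ger0_norm ?fine_ge0 // -lte_fin fineK //.
by rewrite ge0_fin_numE // (lt_trans lte) // ltry.
Qed.

End Lp_norms.

(** * Codes of the approximants *)

Lemma computable_rat_inv_succ f :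
  computable_nat f -> computable_rat_seq (fun n => (f n).+1%:R^-1).
Proof.
move=> cf; apply: eq_computable_rat_seq
  (computable_rat_ratio (fun=> 1%N) f (computable_nat_const 1) cf) => n.
by rewrite mul1r.
Qed.

Ltac rat_computability :=
  lazymatch goal with
  | H : computable_rat_seq ?a |- computable_rat_seq ?a => exact H
  | H : computable_rat_seq (fun z => ?f (cfst z) (csnd z))
    |- computable_rat_seq (fun n => ?f (@?g n) (@?h n)) =>
      let K := fresh in
      have K := computable_rat_comp _ (fun n => cpair (g n) (h n)) H _;
      refine (eq_computable_rat_seq _ _ _ (K _));
        [by move=> ?; rewrite !cpairE | computability]
  | |- computable_rat_seq (fun n => (@?f n) + (@?g n)) =>
      apply (computable_rat_add f g); rat_computability
  | |- computable_rat_seq (fun n => (@?f n) * (@?g n)) =>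
      apply (computable_rat_mul f g); rat_computability
  | |- computable_rat_seq (fun n => - (@?f n)) =>
      apply (computable_rat_opp f); rat_computability
  | |- computable_rat_seq (fun n => 2^-1 ^+ (@?f n)) =>
      apply (computable_rat_half_exp f); computability
  | |- computable_rat_seq (fun n => (S (@?f n))%:R^-1) =>
      apply (computable_rat_inv_succ f); computability
  | |- computable_rat_seq (fun n => (@?f n)%:R) =>
      apply (computable_rat_of_nat f); computability
  | |- computable_rat_seq (fun _ => 1) =>
      exact (computable_rat_of_nat (fun=> 1%N) (computable_nat_const 1))
  | |- computable_rat_seq (fun _ => 0) =>
      exact (computable_rat_of_nat (fun=> 0%N) (computable_nat_const 0))
  | |- computable_rat_seq (fun n => Order.max (@?f n) (@?g n)) =>
      apply (computable_rat_max f g); rat_computability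
  | |- computable_rat_seq (fun n => Order.min (@?f n) (@?g n)) =>
      apply (computable_rat_min f g); rat_computability
  | |- computable_rat_seq (fun n => rat_of_code (@?f n)) =>
      apply (computable_rat_code f); computability
  | |- computable_rat_seq _ =>
      tryif refine (computable_rat_if _ _ _ _ _ _)
      then first [rat_computability | computability] else idtac
  | |- computable_bool (fun n => (@?f n <= @?g n)%R) =>
      apply (computable_rat_le f g); rat_computability
  | |- computable_bool _ => computability
  | |- computable_nat _ => computability
  | |- _ => idtac
  end.

(** By monotonicity of [halts], counting the failing stages below n gives the first halting stage
    once n has reached it, and n before that. No unbounded search is involved. *)
Definition halting_time (n i : nat) : nat :=
  (\sum_(0 <= s < n) ~~ halts i s)%N.

(* The rotation angle of the i-th cell as known at stage n. *)
Definition angle (n i : nat) : rat :=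
  if halts i n then 2^-1 ^+ i.+1 * (2 * halting_time n i).+2%:R^-1 else 0.

Lemma computable_angle : computable_rat_seq (fun z => angle (cfst z) (csnd z)).
Proof.
have ch := computable_halts; have cht : computable_nat2_nat halting_time.
  rewrite /halting_time.
  apply: (computable_nat_sum (fun z s => ~~ halts (csnd z) s) cfst);
    by computability.
rewrite /angle; rat_computability.
Qed.

Lemma halting_time_stable m n i : (n <= m)%N -> halts i n ->
  halting_time m i = halting_time n i.
Proof.
move=> nm hn; rewrite /halting_time (big_cat_nat (leq0n n) nm) //=.
rewrite [X in (_ + X)%N]big_nat [X in (_ + X)%N]big1 ?addn0 // => s /andP[ns _].
by rewrite (halts_mono _ _ _ ns hn).
Qed.

Lemma halting_time_ge m n i : (n <= m)%N -> ~~ halts i n ->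
  (n <= halting_time m i)%N.
Proof.
move=> nm hn; rewrite /halting_time (big_cat_nat (leq0n n) nm) //=.
rewrite (eq_big_nat _ _ (F2 := fun=> 1%N)) => [|s /andP[_ sn]].
  by rewrite sum_nat_const_nat subn0 muln1 leq_addr.
by rewrite (contra (halts_mono _ _ _ (ltnW sn)) hn).
Qed.

Lemma angle_ge0 n i : 0 <= angle n i.
Proof. by rewrite /angle; case: ifP => // _;
  rewrite mulr_ge0 ?invr_ge0 // exprn_ge0. Qed.

(** A nonzero angle is final. A zero angle at stage n can only be replaced after a halting stage j
    >= n, and then 2 (j + 1) >= n + 1. *)
Lemma angle_close m n i : (n <= m)%N ->
  angle m i = angle n i \/
  angle n i = 0 /\ angle m i <= 2^-1 ^+ i.+1 * n.+1%:R^-1.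
Proof.
move=> nm; rewrite /angle; have [hn|hn] := boolP (halts i n).
  by left; rewrite (halts_mono _ _ _ nm hn) (halting_time_stable _ _ _ nm hn).
right; split=> //; case: ifP => _; last by rewrite mulr_ge0 ?invr_ge0 //
  exprn_ge0.
rewrite ler_wpM2l ?exprn_ge0 // lef_pV2 ?posrE ?ltr0n // ler_nat.
by have := halting_time_ge _ _ _ nm hn; lia.
Qed.

Lemma angle_le n i : angle n i <= 2^-1 ^+ i.+1.
Proof.
(* Comparison with stage 0, where no program has halted and the bound is the full cell length. *)
have [->|[_]] := angle_close n 0 i isT; last by rewrite divr1.
by rewrite /angle halts0 exprn_ge0.
Qed.

Definition limit_angle (i : nat) : rat :=
  if pselect (exists s, halts i s) is left h then angle (ex_minn h) i else 0.

Lemma limit_angleE i : exists n0, forall n, (n0 <= n)%N -> angle n i =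
  limit_angle i.
Proof.
rewrite /limit_angle; case: pselect => [h|h]; last first.
  by exists 0%N => n _; rewrite /angle; case: ifP => // hn; case: h; exists n.
case: ex_minnP => s hs _; exists s => n sn.
by rewrite /angle hs (halts_mono _ _ _ sn hs) (halting_time_stable _ _ _ sn hs).
Qed.

Lemma limit_angle_close n i :
  limit_angle i = angle n i \/
  angle n i = 0 /\ limit_angle i <= 2^-1 ^+ i.+1 * n.+1%:R^-1.
Proof.
have [n0 hn0] := limit_angleE i; rewrite -(hn0 (maxn n0 n) (leq_maxl _ _)).
exact/angle_close/leq_maxr.
Qed.

(** The code of a simple function is one flat list, while the approximants are indexed by a term t
    and an interval u; they are enumerated by m = t * N + u. *)
Lemma sum_divn_modn (V : nmodType) (F : nat -> nat -> V) (K N : nat) :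
  \sum_(0 <= m < K * N) F (m %/ N)%N (m %% N)%N =
  \sum_(0 <= t < K) \sum_(0 <= u < N) F t u.
Proof.
have [->|N0] := posnP N.
  by rewrite muln0 big_nil big1 // => t _; rewrite big_nil.
elim: K => [|K IHK]; first by rewrite mul0n !big_nil.
rewrite big_nat_recr //= -IHK mulSn (big_cat_nat (leq0n (K * N)%N)) ?leq_addl
  //=.
congr (_ + _); rewrite -{1}[(K * N)%N]add0n big_addn addnK.
rewrite big_nat [RHS]big_nat; apply: eq_bigr => u /andP[_ uN].
by rewrite divnDMl // divn_small // add0n addnC modnMDl modn_small.
Qed.

Definition left_rat (i : nat) : rat := 1 - 2^-1 ^+ i.

(* On the u-th of the intervals [breakpoint n u, breakpoint n u.+1), which cut
   each cell in two, the rotation at stage n is the translation by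
   [offset n u]. *)
Definition breakpoint (n u : nat) : rat :=
  if (u %% 2 == 0)%N then left_rat (u %/ 2)
  else left_rat (u %/ 2).+1 - angle n (u %/ 2).

Definition offset (n u : nat) : rat :=
  if (u %% 2 == 0)%N then angle n (u %/ 2)
  else angle n (u %/ 2) - 2^-1 ^+ (u %/ 2).+1.

Lemma computable_breakpoint :
  computable_rat_seq (fun z => breakpoint (cfst z) (csnd z)).
Proof.
have ca := computable_angle; rewrite /breakpoint /left_rat; rat_computability.
Qed.

Lemma computable_offset : computable_rat_seq
  (fun z => offset (cfst z) (csnd z)).
Proof. have ca := computable_angle; rewrite /offset; rat_computability. Qed.

Definition term_code (e t : nat) : nat := cfst (iter t csnd (csnd e)).
Definition term_coef (e t : nat) : rat := rat_of_code (cfst (term_code e t)).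
Definition term_lo (e t : nat) : rat := rat_of_code
  (cfst (csnd (term_code e t))).
Definition term_hi (e t : nat) : rat := rat_of_code
  (csnd (csnd (term_code e t))).

Lemma simple_termsE e : simple_terms e =
  [seq (term_coef e t, (term_lo e t, term_hi e t)) | t <- iota 0 (cfst e)].
Proof. by []. Qed.

(** On each interval of the first n cells the rotation is a translation, so the pullback of a term
    is the indicator of the translated interval cut down to that interval. The result is again an
    interval, empty when the max exceeds the min. The remaining cells, of total length 2^-n, are
    dropped. *)
Lemma koopman_approximants : exists2 s, computable_nat2_nat s & forall e n,
  simple_terms (s e n) =
  [seq (let t := (m %/ (2 * n))%N in let u := (m %% (2 * n))%N in
        (term_coef e t,
         (Num.max (term_lo e t - offset n u) (breakpoint n u),
          Num.min (term_hi e t - offset n u) (breakpoint n u.+1))))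
  | m <- iota 0 (cfst e * (2 * n))].
Proof.
have cb := computable_breakpoint; have co := computable_offset.
have ct : computable_nat2_nat term_code.
  by rewrite /term_code; computability.
have [| | | |s cs sE] := computable_simple_terms
  (fun z => cfst (cfst z) * (2 * csnd z))%N
  (fun z m => term_coef (cfst z) (m %/ (2 * csnd z)))
  (fun z m => Num.max (term_lo (cfst z) (m %/ (2 * csnd z)) -
                         offset (csnd z) (m %% (2 * csnd z)))
                      (breakpoint (csnd z) (m %% (2 * csnd z))))
  (fun z m => Num.min (term_hi (cfst z) (m %/ (2 * csnd z)) -
                         offset (csnd z) (m %% (2 * csnd z)))
                      (breakpoint (csnd z) (m %% (2 * csnd z)).+1)).
- by computability.
- by rewrite /term_coef; rat_computability.
- by rewrite /term_lo; rat_computability.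
- by rewrite /term_hi; rat_computability.
exists (fun e n => s (cpair e n)); first by computability.
by move=> e n; rewrite sE !cpairE.
Qed.

(** A computable bound on the supremum of the simple function, from |(p - q) / (d + 1)| <= p + q. *)
Definition coef_bound (e : nat) : nat :=
  \sum_(0 <= t < cfst e) (cfst (cfst (cfst (term_code e t))) +
                          csnd (cfst (cfst (term_code e t))))%N.

Lemma computable_coef_bound : computable_nat coef_bound.
Proof.
have ct : computable_nat2_nat term_code.
  by rewrite /term_code; computability.
apply: (computable_nat_sum (fun e t => cfst (cfst (cfst (term_code e t))) +
  csnd (cfst (cfst (term_code e t))))%N cfst); by computability.
Qed.

Lemma coef_boundP e :
  \sum_(0 <= t < cfst e) `|term_coef e t| <= (coef_bound e)%:R.
Proof.
rewrite natr_sum; apply: ler_sum => t _.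
rewrite /term_coef /rat_of_code normrM [`|_^-1|]ger0_norm ?invr_ge0 //.
rewrite ler_pdivrMr ?ltr0n //; apply: le_trans (ler_normB _ _) _.
by rewrite !normr_nat -natrD -natrM ler_nat leq_pmulr.
Qed.

(** * Approximation of the Koopman operator *)

Lemma breakpoint_even n i : breakpoint n (2 * i) = left_rat i.
Proof. by rewrite /breakpoint modnMr mulKn. Qed.

Lemma breakpoint_odd n i : breakpoint n (2 * i).+1 = left_rat i.+1 - angle n i.
Proof.
rewrite /breakpoint (_ : ((2 * i).+1 %% 2 = 1)%N); last by lia.
by rewrite (_ : ((2 * i).+1 %/ 2 = i)%N); last by lia.
Qed.

Lemma offset_even n i : offset n (2 * i) = angle n i.
Proof. by rewrite /offset modnMr mulKn. Qed.

Lemma offset_odd n i : offset n (2 * i).+1 = angle n i - 2^-1 ^+ i.+1.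
Proof.
rewrite /offset (_ : ((2 * i).+1 %% 2 = 1)%N); last by lia.
by rewrite (_ : ((2 * i).+1 %/ 2 = i)%N); last by lia.
Qed.

Lemma left_ratS i : left_rat i.+1 = left_rat i + 2^-1 ^+ i.+1.
Proof. by rewrite /left_rat exprS; lra. Qed.

Lemma breakpointS_le n u : breakpoint n u <= breakpoint n u.+1.
Proof.
have [i [->|->]] : exists i, (u = 2 * i \/ u = (2 * i).+1)%N.
  by exists (u %/ 2)%N; lia.
- by rewrite breakpoint_even breakpoint_odd left_ratS; have := angle_le n i;
    lra.
- rewrite breakpoint_odd (_ : (2 * i).+2 = 2 * i.+1)%N; last by lia.
  by rewrite breakpoint_even; have := angle_ge0 n i; lra.
Qed.

Lemma breakpoint_le n u v : (u <= v)%N -> breakpoint n u <= breakpoint n v.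
Proof.
move=> /subnK <-; elim: (v - u)%N => [|k IHk]; first by rewrite add0n.
by rewrite addSn (le_trans IHk) // breakpointS_le.
Qed.

Section koopman_approximation.
Context {R : realType}.
Implicit Types (x y : R) (e n i m : nat).
Local Notation mu := (@lebesgue_measure R).

(** A null set off which open and closed intervals with rational endpoints have the same indicator;
    adjacent closed intervals then no longer overlap. *)
Definition rat_set : set R := range ratr.

Definition stage_shift n i : R := ratr (angle n i).
Definition limit_shift i : R := ratr (limit_angle i).

Lemma ratr_half_exp i : ratr (2^-1 ^+ i) = 2^-1 ^+ i :> R.
Proof. by rewrite rmorphXn /= fmorphV /= ratr_nat. Qed.

Lemma ratr_left_rat i : ratr (left_rat i) = left_end i :> R.
Proof. by rewrite rmorphB /= rmorph1 ratr_half_exp. Qed.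

Lemma ratr_half_end i :
  ratr (left_rat i + 2^-1 ^+ i.+2) = left_end i + len i / 2 :> R.
Proof.
rewrite (rmorphD _ (left_rat i)) /= ratr_left_rat ratr_half_exp.
by rewrite /len [in LHS]exprS mulrC.
Qed.

Lemma ratr_max (a b : rat) : ratr (Num.max a b) = Num.max (ratr a) (ratr b) :>
  R.
Proof. by rewrite /Order.max ltr_rat; case: ifP. Qed.

Lemma ratr_min (a b : rat) : ratr (Num.min a b) = Num.min (ratr a) (ratr b) :>
  R.
Proof. by rewrite /Order.min ltr_rat; case: ifP. Qed.

Lemma is_shift_stage n : is_shift (stage_shift n).
Proof.
move=> i; rewrite /stage_shift ler0q angle_ge0 /= /len -ratr_half_exp ler_rat.
exact: angle_le.
Qed.

Lemma is_shift_limit : is_shift limit_shift.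
Proof.
move=> i; have [n0 hn0] := limit_angleE i; rewrite /limit_shift.
by rewrite -(hn0 n0 (leqnn _)); exact: is_shift_stage.
Qed.

Lemma simple_funE e x : simple_fun e x = \sum_(0 <= t < cfst e)
  ratr (term_coef e t) * \1_(`[ratr (term_lo e t), ratr (term_hi e t)]) x.
Proof. by rewrite /simple_fun simple_termsE big_map /index_iota subn0. Qed.

Lemma simple_fun_le e x : `|simple_fun e x| <= (coef_bound e)%:R.
Proof.
rewrite simple_funE; apply: le_trans (ler_norm_sum _ _ _) _.
rewrite -[leRHS](ratr_nat R); apply: le_trans (_ : _ <= ratr _) _; last first.
  by rewrite ler_rat; exact: coef_boundP.
rewrite rmorph_sum /=; apply: ler_sum => t _.
rewrite normrM ratr_norm ler_piMr // indicE.
by case: (_ \in _); rewrite ?normr1 ?normr0.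
Qed.

Lemma indic_itv_rat (a b : rat) x : ~ rat_set x ->
  \1_(`[ratr a, ratr b]) x = (ratr a < x < ratr b)%R%:R :> R.
Proof.
move=> xQ; rewrite indicE mem_setE in_itv /= !le_eqVlt.
have nQ q : (x == ratr q) = false by apply/eqP => xq; apply: xQ; exists q.
by rewrite eq_sym nQ nQ.
Qed.

Section approximants.
Variable s : nat -> nat -> nat.
Hypothesis sE : forall e n, simple_terms (s e n) =
  [seq (let t := (m %/ (2 * n))%N in let u := (m %% (2 * n))%N in
        (term_coef e t,
         (Num.max (term_lo e t - offset n u) (breakpoint n u),
          Num.min (term_hi e t - offset n u) (breakpoint n u.+1))))
  | m <- iota 0 (cfst e * (2 * n))].

Lemma approximantE e n x : ~ rat_set x -> simple_fun (s e n) x =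
  \sum_(0 <= t < cfst e) ratr (term_coef e t) * \sum_(0 <= u < 2 * n)
    ((ratr (term_lo e t) < x + ratr (offset n u) < ratr (term_hi e t)) &&
     (ratr (breakpoint n u) < x < ratr (breakpoint n u.+1)))%:R.
Proof.
move=> xQ; rewrite /simple_fun sE big_map.
under [RHS]eq_bigr do rewrite mulr_sumr.
rewrite -sum_divn_modn /index_iota subn0; apply: eq_bigr => m _ /=.
rewrite indic_itv_rat //; congr (_ * _%:R).
rewrite ratr_max ratr_min !rmorphB /=.
rewrite gt_max lt_min ltrBlDr ltrBrDr.
by rewrite andbACA.
Qed.

Lemma approximant_tail e n x : ~ rat_set x -> left_end n <= x ->
  simple_fun (s e n) x = 0.
Proof.
move=> xQ nx; rewrite approximantE // big1 // => t _.
rewrite big_nat big1 ?mulr0 // => u /andP[_ un].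
rewrite (_ : (x < ratr (breakpoint n u.+1)) = false) ?andbF //.
apply/negbTE; rewrite -leNgt; apply: le_trans nx.
by rewrite -ratr_left_rat -(breakpoint_even n) ler_rat; exact: breakpoint_le.
Qed.

Lemma approximant_rot e n x : ~ rat_set x -> 0 <= x < left_end n ->
  simple_fun (s e n) x = simple_fun e (cell_rot (stage_shift n) x).
Proof.
move=> xQ /andP[x0 xn].
have [|i ix] := cell_cover x; first by have := @left_end_lt1 R n; lra.
have iltn : (i < n)%N.
  rewrite ltnNge; apply/negP => /(@left_end_le R); move: ix; rewrite /cell /=;
    lra.
have nQ q : (ratr q == x) = false by apply/eqP => xq; apply: xQ; exists q.
have nQD q q' : (ratr q == x + ratr q') = false.
  apply/eqP => xq; apply: xQ; exists (q - q') => //.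
  by rewrite rmorphB /= xq addrK.
(* The one interval containing x: number 2 i if the rotation of x does not wrap around, 2 i + 1 if
   it does. All other summands vanish by monotonicity of the breakpoints. *)
have [u [un bu ub rotE]] : exists u, [/\ (u < 2 * n)%N, ratr (breakpoint n u)
  <= x,
    x < ratr (breakpoint n u.+1) & cell_rot (stage_shift n) x = x + ratr
      (offset n u)].
  move: (ix); rewrite /cell /= => /andP[ix1 ix2].
  rewrite (cell_rotE _ i) // /rotation.
  case: (ltP (x + _) (left_end i.+1)) => h.
    exists (2 * i)%N; rewrite breakpoint_even breakpoint_odd offset_even.
    split => //; first lia.
      by rewrite ratr_left_rat.
    by rewrite rmorphB /= ratr_left_rat ltrBrDr.
  exists (2 * i).+1; rewrite breakpoint_odd (_ : (2 * i).+2 = 2 * i.+1)%N;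
    last by lia.
  rewrite breakpoint_even offset_odd; split => //; first lia.
  - by rewrite rmorphB /= ratr_left_rat lerBlDr.
  - by rewrite ratr_left_rat.
  - by rewrite rmorphB /= ratr_half_exp addrA.
rewrite approximantE // simple_funE; apply: eq_bigr => t _; congr (_ * _).
rewrite big_mkord (bigD1 (Ordinal un)) //= big1 ?addr0 => [|v vu].
  rewrite rotE indicE mem_setE in_itv /= ub andbT.
  rewrite [ratr (breakpoint n u) < x]lt_neqAle nQ bu /= andbT !le_eqVlt nQD.
  by rewrite (eq_sym (x + _)) nQD.
rewrite (_ : _ < x < _ = false) ?andbF //.
apply/negbTE/negP => /andP[bv vb].
have [vltu|ultv|uv] := ltngtP v u.
- have := breakpoint_le n _ _ vltu; rewrite -(ler_rat R); lra.
- have := breakpoint_le n _ _ ultv; rewrite -(ler_rat R); lra.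
- by case/eqP: vu; apply: val_inj.
Qed.

End approximants.

Lemma measurable_simple_fun e : measurable_fun setT (@simple_fun R e).
Proof.
rewrite (_ : @simple_fun R e = fun x => \sum_(0 <= t < cfst e)
  ratr (term_coef e t) * \1_(`[ratr (term_lo e t), ratr (term_hi e t)]) x).
  by apply: measurable_sum => t; exact: measurable_funM.
by apply/funext => x; rewrite simple_funE.
Qed.

(** A point outside this set stays on the same side of a when it is shifted forward by at most
    eta. *)
Definition near_below (eta a : R) : set R := `[a - eta, a].

(* Outside this set, rotations by angles at most [len i / n.+1] neither wrap
   around nor change the values of the simple function coded by e. *)
Definition exceptional e n : set R :=
  (`[left_end n, 1]%classic `|`
   \bigcup_i near_below (len i / n.+1%:R) (left_end i.+1)) `|`
  \bigcup_(t < cfst e) (near_below n.+1%:R^-1 (ratr (term_lo e t)) `|`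
                        near_below n.+1%:R^-1 (ratr (term_hi e t))).

Lemma measurable_exceptional e n : measurable (exceptional e n).
Proof.
apply: measurableU; last first.
  apply: bigcup_measurable => t _; apply: measurableU; exact: measurable_itv.
apply: measurableU; first exact: measurable_itv.
apply: bigcupT_measurable => i; exact: measurable_itv.
Qed.

Lemma mu_near_below (eta a : R) : 0 <= eta -> mu (near_below eta a) = eta%:E.
Proof.
move=> eta0; rewrite /near_below lebesgue_measure_itv /= lte_fin.
case: ltP => h; first by rewrite -EFinB; congr (_%:E); ring.
by congr (_%:E); lra.
Qed.

Lemma half_exp_le n : 2^-1 ^+ n <= n.+1%:R^-1 :> R.
Proof.
rewrite exprVn lef_pV2 ?posrE ?exprn_gt0 ?ltr0n // -natrX ler_nat.
exact: ltn_expl.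
Qed.

(** The cells beyond n contribute 2^-n <= 1/(n + 1), the wrap-around zones 1/(n + 1) in total
    because the cell lengths sum to 1, and each of the 2 * cfst e endpoints 1/(n + 1). *)
Lemma mu_exceptional e n :
  (mu (exceptional e n) <= ((2 * cfst e + 2)%:R / n.+1%:R)%:E)%E.
Proof.
have n0 : 0 <= n.+1%:R^-1 :> R by rewrite invr_ge0.
have mw : measurable (\bigcup_i near_below (len i / n.+1%:R) (left_end i.+1) :
  set R).
  by apply: bigcupT_measurable => i; exact: measurable_itv.
have mt k : measurable (\bigcup_(t < k)
    (near_below n.+1%:R^-1 (ratr (term_lo e t)) `|`
     near_below n.+1%:R^-1 (ratr (term_hi e t))) : set R).
  by apply: bigcup_measurable => t _; apply: measurableU; exact: measurable_itv.
have hw : (mu (\bigcup_i near_below (len i / n.+1%:R) (left_end i.+1))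
    <= (n.+1%:R^-1)%:E)%E.
  apply: (le_trans (measure_sigma_subadditive mu
    (F := fun i => near_below (len i / n.+1%:R) (left_end i.+1)) _ mw _)) => //.
  - by move=> i; exact: measurable_itv.
  - apply: le_trans (epsilon_trick0 xpredT n0); apply: lee_nneseries => // i _.
    rewrite [leLHS]mu_near_below; last by rewrite mulr_ge0 // ltW // len_gt0.
    by rewrite lee_fin /len exprVn natrX mulrC.
have ht k : (mu (\bigcup_(t < k)
    (near_below n.+1%:R^-1 (ratr (term_lo e t)) `|`
     near_below n.+1%:R^-1 (ratr (term_hi e t)))) <=
       ((2 * k)%:R / n.+1%:R)%:E)%E.
  elim: k => [|k IHk].
    by rewrite II0 bigcup_set0 measure0 muln0 mul0r.
  rewrite IIS bigcup_setU bigcup_set1.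
  apply: le_trans (measureU2 _ _ _) _; first exact: mt.
    by apply: measurableU; exact: measurable_itv.
  rewrite mulnS addnC natrD mulrDl EFinD leeD //.
  apply: le_trans (measureU2 _ _ _) _;
    [exact: measurable_itv|exact: measurable_itv|].
  rewrite [X in (X + _)%E]mu_near_below // [X in (_ + X)%E]mu_near_below //.
  by rewrite -EFinD lee_fin -mulr2n mulr_natl.
apply: le_trans (measureU2 _ _ _) _; [exact: measurableU|exact: mt|].
rewrite natrD mulrDl EFinD addeC leeD //; last exact: ht.
apply: le_trans (measureU2 _ _ _) _ => //.
rewrite (_ : 2 / n.+1%:R = n.+1%:R^-1 + n.+1%:R^-1); last by ring.
rewrite EFinD leeD // [leLHS]lebesgue_measure_itv /= lte_fin left_end_lt1
  -EFinB lee_fin.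
by rewrite /left_end opprB addrC subrK half_exp_le.
Qed.

(** Stated for two shift sequences so as to compare a stage both with the limit and with another
    stage. *)
Lemma simple_fun_cell_rot_close e n (d d' : nat -> R) x :
  is_shift d -> is_shift d' ->
  (forall i, d i = d' i \/ d i <= len i / n.+1%:R /\ d' i <= len i / n.+1%:R) ->
  I01 x -> ~ exceptional e n x ->
  simple_fun e (cell_rot d x) = simple_fun e (cell_rot d' x).
Proof.
move=> sd sd' dd' Ix nEx.
have x01 : 0 <= x < 1.
  move: Ix; rewrite /I01 /= in_itv /= => /andP[x0 x1];
    rewrite x0 /= lt_neqAle x1 andbT.
  apply/eqP => x1'; apply: nEx; left; left; rewrite x1' /= in_itv /= lexx andbT.
  exact/ltW/left_end_lt1.
have [i ix] := cell_cover x x01.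
have [dE|[di d'i]] := dd' i; first by rewrite !(cell_rotE _ i) // dE.
have wrap c : c <= len i / n.+1%:R -> rotation c i x = x + c.
  move=> ci; rewrite /rotation; case: ltP => // h; exfalso; apply: nEx.
  left; right; exists i => //; rewrite /near_below /= in_itv /=.
  by move: ix ci h; rewrite /cell /=; move: (len i / _) => w; lra.
rewrite !(cell_rotE _ i) // !wrap // !simple_funE.
have le_eta : len i / n.+1%:R <= n.+1%:R^-1 :> R.
  by rewrite ler_piMl ?invr_ge0 // (le_trans (len_le_half i)) //; lra.
have /andP[d0 _] := sd i; have /andP[d'0 _] := sd' i.
rewrite big_nat [RHS]big_nat; apply: eq_bigr => t /andP[_ tK]; congr (_ * _).
have nlo : ~ near_below n.+1%:R^-1 (ratr (term_lo e t)) x.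
  by move=> h; apply: nEx; right; exists t => //; left.
have nhi : ~ near_below n.+1%:R^-1 (ratr (term_hi e t)) x.
  by move=> h; apply: nEx; right; exists t => //; right.
move: nlo nhi; rewrite /near_below /= !in_itv /= => /negP nlo /negP nhi.
move: le_eta di d'i nlo nhi.
move: n.+1%:R^-1 (len i / n.+1%:R) => eta w le_eta di d'i nlo nhi.
rewrite !indicE !mem_setE !in_itv /=; congr (nat_of_bool _)%:R.
move: (ratr (term_lo e t)) (ratr (term_hi e t)) nlo nhi => lo hi.
rewrite !negb_and -!ltNge => nlo nhi.
have -> : (lo <= x + d i) = (lo <= x + d' i).
  by case/orP: nlo => h; [rewrite !leNgt; congr negb; apply/idP/idP;
    lra|apply/idP/idP; lra].
by case/orP: nhi => h; congr (_ && _);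
  [apply/idP/idP; lra|rewrite !leNgt; congr negb; apply/idP/idP; lra].
Qed.

End koopman_approximation.

Section computable_koopman.
Context {R : realType}.
Implicit Types (x : R) (e n i m : nat).
Local Notation mu := (@lebesgue_measure R).

Definition tau : R -> R := cell_rot limit_shift.

Lemma negligible_rat_set : mu.-negligible (@rat_set R).
Proof.
have mQ : measurable (@rat_set R).
  rewrite (_ : rat_set = \bigcup_q [set ratr q : R]); last first.
    by apply/seteqP; split => [_ [q _ <-]|_ [q _ ->]]; exists q.
  by apply: countable_bigcupT_measurable; [exact: countableP|move=> q].
by exists rat_set; split => //; exact: lebesgue_measure_rat.
Qed.

(** With M the coefficient bound and K the number of terms, the squared distance is at most (2 M)^2
    (2 K + 2) / (n + 1); the rate pushes it below 1 / (inv_trunc eps + 1)^2, hence below eps^2. *)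
Definition koopman_rate e (eps : rat) : nat :=
  (8 * (coef_bound e).+1 ^ 2 * (cfst e).+1 * (inv_trunc eps).+1 ^ 2)%N.

Lemma computable_koopman_rate : computable_nat_rat_nat koopman_rate.
Proof.
have cM := computable_coef_bound; have cI := computable_inv_trunc.
have cI' : computable_nat (fun z => inv_trunc (rat_of_code (csnd z))).
  by apply: (computable_nat_comp _ csnd cI); computability.
rewrite /computable_nat_rat_nat /koopman_rate.
computability.
Qed.

(** Satisfied by the Koopman image and by every approximant of index at least n, so that one
    estimate gives both the convergence and its rate. *)
Definition approximates e n (g : R -> R) :=
  [/\ measurable_fun setT g,
      forall x, I01 x -> ~ rat_set x -> `|g x| <= (coef_bound e)%:R &
      forall x, I01 x -> ~ rat_set x -> ~ exceptional e n x ->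
        g x = simple_fun e (cell_rot (stage_shift n) x)].

Lemma lt_ratr_inv_trunc (eps : rat) : 0 < eps ->
  (inv_trunc eps).+1%:R^-1 < ratr eps :> R.
Proof.
move=> eps0; rewrite -(ratr_nat R) -fmorphV /= ltr_rat; exact: inv_trunc_lt.
Qed.

Lemma approximates_close e n g g' (eps : rat) : 0 < eps ->
  (koopman_rate e eps <= n)%N -> approximates e n g -> approximates e n g' ->
  (Lp_norm 2 (g \- g')%R < (ratr eps)%:E)%E.
Proof.
move=> eps0 rn [mg gM gE] [mg' g'M g'E].
set M := (coef_bound e)%:R : R; have M0 : 0 <= M by [].
have epsR : 0 < ratr eps :> R by rewrite ltr0q.
apply: (lt_Lp_norm 2 (g \- g') rat_set (exceptional e n) (2 * M) 0
         ((2 * cfst e + 2)%:R / n.+1%:R)) => //.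
- exact: measurable_funB.
- exact: negligible_rat_set.
- exact: measurable_exceptional.
- exact: mu_exceptional.
- by rewrite mulr_ge0.
- move=> x Ix xQ _ /=; apply: le_trans (ler_normB _ _) _.
  by rewrite mulr_natl mulr2n lerD // ?gM ?g'M.
- by move=> x Ix xQ xE /=; rewrite gE // g'E // subrr normr0.
rewrite powR0 // addr0 powR_mulrn ?mulr_ge0 // powR_mulrn ?(ltW epsR) //.
have := lt_ratr_inv_trunc _ eps0; move: rn; rewrite /koopman_rate.
set k := inv_trunc eps; set K := cfst e; rewrite {M0}/M.
set M := coef_bound e => rn keps.
apply: (@lt_trans _ _ (k.+1%:R^-1 ^+ 2)); last first.
  by rewrite ltrXn2r // ?invr_ge0 // ltW.
rewrite mulrA ltr_pdivrMr ?ltr0n // exprVn ltr_pdivlMl ?exprn_gt0 ?ltr0n //.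
rewrite -!natrX -!natrM -?natrX -!natrM ltr_nat. 
have : (4 * M ^ 2 * (2 * K + 2) <= 8 * M.+1 ^ 2 * K.+1)%N.
  nia.
move=> h; rewrite ltnS; apply: leq_trans rn; rewrite mulnC leq_mul2r.
by rewrite expnMn h orbT.
Qed.

Lemma computable_tau : computable_transformation tau.
Proof.
have [s cs sE] := koopman_approximants.
have ratr_close n i (q q' : rat) :
    q = q' \/ q' = 0 /\ q <= 2^-1 ^+ i.+1 * n.+1%:R^-1 ->
    ratr q = ratr q' :> R \/
    (ratr q : R) <= len i / n.+1%:R /\ (ratr q' : R) <= len i / n.+1%:R.
  move=> [->|[-> le]]; [by left|right; rewrite rmorph0; split].
    by rewrite /len -ratr_half_exp -(ratr_nat R) -fmorphV -rmorphM ler_rat.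
  by rewrite divr_ge0 // ltW // len_gt0.
have koopman_approximates e n : approximates e n (koopman tau (simple_fun e)).
  split.
  - apply: measurableT_comp; first exact: measurable_simple_fun.
    exact: measurable_cell_rot.
  - by move=> x _ _; exact: simple_fun_le.
  - move=> x Ix _ xE; apply: simple_fun_cell_rot_close xE => //.
    + exact: is_shift_limit.
    + exact: is_shift_stage.
    by move=> i; apply: ratr_close; exact: limit_angle_close.
(* The m-th approximant follows the rotation of stage m, which off the exceptional set cannot be
   told from that of stage n. *)
have s_approximates e n m : (n <= m)%N -> approximates e n (simple_fun (s e m)).
  move=> nm; have seE x : I01 x -> ~ rat_set x -> simple_fun (s e m) x =
      if x < left_end m then simple_fun e (cell_rot (stage_shift m) x) else 0.
    move=> Ix xQ; case: ltP => xm; last exact: approximant_tail.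
    apply: approximant_rot => //; rewrite xm andbT.
    by move: Ix; rewrite /I01 /= in_itv /= => /andP[].
  split.
  - exact: measurable_simple_fun.
  - move=> x Ix xQ; rewrite seE //; case: ifP => _; first exact: simple_fun_le.
    by rewrite normr0.
  - move=> x Ix xQ xE; rewrite seE // ifT; last first.
      rewrite ltNge; apply/negP => mx; apply: xE; left; left.
      move: Ix; rewrite /I01 /= !in_itv /= => /andP[_ ->]; rewrite andbT.
      by rewrite (le_trans (left_end_le _ _ nm)).
    apply: simple_fun_cell_rot_close xE => //.
    + exact: is_shift_stage.
    + exact: is_shift_stage.
    by move=> i; apply: ratr_close; exact: angle_close.
split.
  move=> e; have [mk _ _] := koopman_approximates e 0%N.
  apply: bounded_in_Lp => // x _; exact: simple_fun_le.
exists s, koopman_rate; split.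
- exact: cs.
- exact: computable_koopman_rate.
- move=> e; apply: cvg_LpP => eps eps0.
  (* Rates take rational arguments, so a rational is inserted below the real eps. *)
  have [q q0 qeps] : exists2 q : rat, 0 < q & ratr q < eps.
    have [q] := rat_in_itvoo eps0; rewrite in_itv /= ltr0q => /andP[q0 qe].
    by exists q.
  exists (koopman_rate e q) => n rn.
  apply: lt_trans (_ : _ < (ratr q)%:E)%E _; last by rewrite lte_fin.
  apply: approximates_close rn _ _ => //; exact: s_approximates.
- move=> e eps eps0 m rm; apply: (approximates_close e (koopman_rate e eps)) =>
    //.
  exact: s_approximates.
  exact: s_approximates.
Qed.
End computable_koopman.

(** * Ergodic averages *)

Section half_set.
Context {R : realType}.
Implicit Types (x : R) (e n i m : nat).
Local Notation mu := (@lebesgue_measure R).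

(** * The set A and its computability *)

Definition left_half i : set R := `[left_end i, left_end i + len i / 2[.
Definition half_set : set R := \bigcup_i left_half i.

Lemma left_half_cell i x : left_half i x -> cell i x.
Proof.
rewrite /left_half /cell /= in_itv /= left_endS; have := @len_gt0 R i; lra.
Qed.

Lemma half_setE i x : cell i x -> half_set x <-> x < left_end i + len i / 2.
Proof.
move=> ix; split=> [[j _ jx]|xi].
  by rewrite (cell_inj _ _ _ ix (left_half_cell _ _ jx));
    move: jx; rewrite /left_half /= in_itv /= => /andP[].
by exists i => //; move: ix; rewrite /left_half /cell /= in_itv /=; lra.
Qed.

Lemma measurable_half_set : measurable half_set.
Proof. by apply: bigcupT_measurable => i; exact: measurable_itv. Qed.

Lemma half_set_I01 : half_set `<=` @I01 R.
Proof.
by move=> x [i _ /left_half_cell/cell_sub]; rewrite /I01 /= in_itv /=; lra.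
Qed.

Lemma indic_half_set i x :
  cell i x -> \1_half_set x = (x < left_end i + len i / 2)%R%:R :> R.
Proof.
move=> ix; rewrite indicE; congr (nat_of_bool _)%:R.
by apply/idP/idP => [/set_mem /(half_setE _ _ ix)|/(half_setE _ _ ix) /mem_set].
Qed.

Lemma indic_bounds (A : set R) x : 0 <= (\1_A x : R) <= 1.
Proof. by rewrite indicE ler0n lern1 leq_b1. Qed.

(** The approximants are sums over the first n left halves, whose midpoints are [left_rat i] plus
    2^-(i + 2). The error sits in [1 - 2^-n, 1], of measure 2^-n <= 1/(n + 1), so [inv_trunc] is a
    rate. *)
Lemma computable_half_set : computable_measurable_fun (\1_half_set : R -> R).
Proof.
have mA : measurable_fun setT (\1_half_set : R -> R).
  by apply: measurable_indic; exact: measurable_half_set.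
split.
  apply: (bounded_in_Lp 1 _ 1) => // x _.
  by have := indic_bounds half_set x => /andP[? ?]; rewrite ger0_norm.
have [| | | |s cs sE] := computable_simple_terms id (fun _ _ => 1)
  (fun _ i => left_rat i) (fun _ i => left_rat i + 2^-1 ^+ i.+2).
- by computability.
- by rat_computability.
- by rewrite /left_rat; rat_computability.
- by rewrite /left_rat; rat_computability.
have seE n x : I01 x -> ~ rat_set x -> simple_fun (s n) x =
    if x < left_end n then \1_half_set x else 0.
  move=> Ix xQ; have x0 : 0 <= x by move: Ix;
    rewrite /I01 /= in_itv /= => /andP[].
  rewrite /simple_fun sE big_map (_ : iota 0 n = index_iota 0 n);
    last by rewrite /index_iota subn0.
  have termE i : ratr (1, (left_rat i, left_rat i + 2^-1 ^+ i.+2)).1 *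
      \1_(`[ratr (left_rat i), ratr (left_rat i + 2^-1 ^+ i.+2)]) x =
      (left_end i < x < left_end i + len i / 2)%R%:R :> R.
    by rewrite /= rmorph1 mul1r indic_itv_rat // ratr_half_end ratr_left_rat.
  rewrite (eq_bigr _ (fun i _ => termE i)); case: ltP => xn; last first.
    rewrite big_nat big1 // => i /andP[_ /(@left_end_le R)].
    rewrite left_endS => h; have := @len_gt0 R i.
    by case: andP => //= -[h1 h2]; lra.
  have [|i ix] := cell_cover x; first by have := @left_end_lt1 R n; lra.
  have iltn : (i < n)%N.
    rewrite ltnNge; apply/negP => /(@left_end_le R).
    by move: ix; rewrite /cell /=; lra.
  rewrite (indic_half_set i) // big_mkord (bigD1 (Ordinal iltn)) //= big1
    ?addr0.
    congr (nat_of_bool _)%:R; move: ix; rewrite /cell /= => /andP[ix _].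
    rewrite lt_neqAle ix andbT; case: eqP => //= ixE; case: xQ.
    by exists (left_rat i) => //; rewrite ratr_left_rat.
  move=> j ji; case: andP => // -[j1 j2]; case/eqP: ji; apply: val_inj => /=.
  apply: (cell_inj _ _ x) => //; apply: left_half_cell.
  by rewrite /left_half /= in_itv /= j2 (ltW j1).
(* One estimate for both comparisons: an approximant with the indicator, and two approximants with
   each other. *)
have close n (g g' : R -> R) (eps : rat) : measurable_fun setT g ->
    measurable_fun setT g' ->
    (forall x, I01 x -> ~ rat_set x -> 0 <= g x <= 1) ->
    (forall x, I01 x -> ~ rat_set x -> 0 <= g' x <= 1) ->
    (forall x, I01 x -> ~ rat_set x -> x < left_end n -> g x = g' x) ->
    0 < eps -> (inv_trunc eps <= n)%N ->
      (Lp_norm 1 (g \- g')%R < (ratr eps)%:E)%E.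
  move=> mg mg' g01 g'01 gg' eps0 en.
  have epsR : 0 < ratr eps :> R by rewrite ltr0q.
  apply: (lt_Lp_norm 1 (g \- g') rat_set `[left_end n, 1]%classic 1 0
           (2^-1 ^+ n)) => //.
  - exact: measurable_funB.
  - exact: negligible_rat_set.
  - rewrite lebesgue_measure_itv /= lte_fin left_end_lt1 -EFinB lee_fin.
    by rewrite /left_end opprB addrC subrK.
  - move=> x Ix xQ _ /=; have := g01 x Ix xQ; have := g'01 x Ix xQ.
    by rewrite ler_norml; lra.
  - move=> x Ix xQ xn /=; rewrite gg' ?subrr ?normr0 // ltNge; apply/negP => nx.
    apply: xn; move: Ix; rewrite /I01 /= !in_itv /= => /andP[_ ->].
    by rewrite nx.
  rewrite powR1 mul1r powR0 // addr0 powRr1 ?(ltW epsR) //.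
  apply: le_lt_trans (half_exp_le _) _;
    apply: le_lt_trans (lt_ratr_inv_trunc _ eps0).
  by rewrite lef_pV2 ?posrE ?ltr0n // ler_nat ltnS.
have s01 n x : I01 x -> ~ rat_set x -> 0 <= (simple_fun (s n) x : R) <= 1.
  move=> Ix xQ; rewrite seE //; case: ifP => _; last by rewrite lexx ler01.
  exact: indic_bounds.
exists s, inv_trunc; split.
- exact: cs.
- exact: computable_inv_trunc.
- apply: cvg_LpP => eps eps0.
  have [q] := rat_in_itvoo eps0; rewrite in_itv /= ltr0q => /andP[q0 qe].
  exists (inv_trunc q) => n qn.
  apply: lt_trans (_ : _ < (ratr q)%:E)%E _; last by rewrite lte_fin.
  apply: (close n) => //.
  + exact: measurable_simple_fun.
  + exact: s01.
  + by move=> x _ _; exact: indic_bounds.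
  + by move=> x Ix xQ xn; rewrite seE // xn.
- move=> eps eps0 m rm; apply: (close (inv_trunc eps)) => //.
  + exact: measurable_simple_fun.
  + exact: measurable_simple_fun.
  + exact: s01.
  + exact: s01.
  + move=> x Ix xQ xn; rewrite !seE // xn (lt_le_trans xn) //.
    exact: left_end_le.
Qed.

End half_set.

Section dynamics.
Context {R : realType}.
Implicit Types (x : R) (e n i m h k : nat).
Local Notation mu := (@lebesgue_measure R).
Local Notation A := (@half_set R).
Local Notation tau := (@tau R).

(** * Iterates of tau on a single cell *)

Definition halting i := exists s, halts i s.

(** The witness h is the halting stage plus one: the factor 2 in the angle makes h steps a half
    turn, and h exceeds every stage at which the program is still running. *)
Lemma limit_shift_halting i : halting i -> exists h, [/\ (0 < h)%N,
  h%:R * limit_shift i = len i / 2 :> R & forall j, ~~ halts i j -> (j < h)%N].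
Proof.
move=> [s hs]; have [n0 hn0] := limit_angleE i.
pose n := maxn n0 s; have hn : halts i n by exact: halts_mono (leq_maxr _ _) hs.
exists (halting_time n i).+1; split => // [|j hj].
  rewrite /limit_shift -(hn0 n (leq_maxl _ _)) /angle hn rmorphM /=
    ratr_half_exp.
  rewrite -/(len i) fmorphV /= ratr_nat
    (_ : (2 * _).+2 = 2 * (halting_time n i).+1)%N; last by lia.
  have nz : (halting_time n i).+1%:R != 0 :> R by rewrite pnatr_eq0.
  by rewrite natrM; move: _.+1%:R nz => y y0; field.
rewrite ltnS; apply: halting_time_ge => //; rewrite leqNgt; apply/negP => nj.
by move: hj; rewrite (halts_mono _ _ _ (ltnW nj) hn).
Qed.

Lemma limit_shift_not_halting i : ~ halting i -> limit_shift i = 0 :> R.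
Proof.
move=> nh; have [n0 hn0] := limit_angleE i.
rewrite /limit_shift -(hn0 n0 (leqnn _)) /angle; case: ifP;
  last by rewrite rmorph0.
by move=> hs; case: nh; exists n0.
Qed.

Lemma rotationD (a b : R) i x : 0 <= a -> 0 <= b -> a + b <= len i -> cell i x
  ->
  rotation b i (rotation a i x) = rotation (a + b) i x.
Proof.
rewrite /cell /rotation /= left_endS => a0 b0 ab /andP[ix xi].
case: (ltP (x + a)) => h1; case: (ltP (_ + b)) => h2;
  case: (ltP (x + (a + b))) => h3;
  lra.
Qed.

Lemma iter_tau_cell i x k : cell i x -> cell i (iter k tau x).
Proof.
move=> ix; elim: k => //= k; apply: cell_rot_cell; exact: is_shift_limit.
Qed.

(** Up to one full turn an orbit wraps around at most once, so a single [rotation] describes the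
    iterate. *)
Lemma iter_tau i x k : k%:R * limit_shift i <= len i :> R -> cell i x ->
  iter k tau x = rotation (k%:R * limit_shift i) i x.
Proof.
have /andP[d0 _] := @is_shift_limit R i.
move=> kd ix; elim: k kd => [|k IHk] kd.
  by rewrite /= mul0r /rotation addr0; move: ix;
    rewrite /cell /= => /andP[_ ->].
move: kd; rewrite -natr1 mulrDl mul1r => kd.
rewrite iterS IHk; last lra.
have kd0 : 0 <= k%:R * limit_shift i :> R by exact: mulr_ge0.
rewrite /tau (cell_rotE _ i) ?rotationD //.
by apply: rotation_cell => //; lra.
Qed.

Lemma ergodic_avgE (f : R -> R) n x :
  ergodic_avg tau f n x = n%:R^-1 * \sum_(0 <= k < n) f (iter k tau x).
Proof.
rewrite /ergodic_avg; congr (_ * _); apply: eq_bigr => k _.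
by elim: k x => //= k IHk x; rewrite /koopman /= -/koopman IHk -iterSr.
Qed.

(* A power of tau acts on a halting cell as a half turn, which exchanges the two
   halves of the cell. *)
Lemma half_turn i h x k : h%:R * limit_shift i = len i / 2 :> R -> cell i x ->
  \1_A (iter (k + h) tau x) = 1 - \1_A (iter k tau x) :> R.
Proof.
move=> hd ix; rewrite addnC iterD; have {ix} := iter_tau_cell _ _ k ix.
move: (iter k tau x) => y iy; have li := @len_gt0 R i.
rewrite (indic_half_set i); last exact: iter_tau_cell.
rewrite (indic_half_set i) //.
rewrite (iter_tau i) //; last by rewrite hd; lra.
rewrite hd /rotation left_endS; move: iy;
  rewrite /cell /= left_endS => /andP[iy yi].
case: (ltP (y + len i / 2) (left_end i + len i)) => h1;
  case: (ltP y (left_end i + len i / 2)) => h2 /=.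
- by case: ltP => h3 /=; lra.
- by exfalso; lra.
- by exfalso; lra.
- by case: ltP => h3 /=; lra.
Qed.

(** The terms k and k + h of a period are opposite, because a half turn exchanges membership in A;
    they cancel in pairs. *)
Lemma centered_sum_period i h x n : h%:R * limit_shift i = len i / 2 :> R ->
  cell i x ->
  \sum_(0 <= k < n + 2 * h) (\1_A (iter k tau x) - 2^-1) =
  \sum_(0 <= k < n) (\1_A (iter k tau x) - 2^-1) :> R.
Proof.
have shift (F : nat -> R) a b :
    \sum_(a <= k < a + b) F k = \sum_(0 <= k < b) F (k + a)%N.
  by rewrite -{1}[a]add0n big_addn addKn.
move=> hd ix; rewrite (big_cat_nat (leq0n n)) ?leq_addr //=.
rewrite -[RHS]addr0; congr (_ + _).
rewrite (@big_cat_nat _ _ _ (n + h)%N) ?leq_addr //=;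
  last by rewrite leq_add2l; lia.
rewrite (_ : (n + 2 * h = n + h + h)%N); last by lia.
rewrite (shift _ n h) (shift _ (n + h)%N h) -big_split big1 // => k _ /=.
by rewrite (_ : (k + (n + h) = k + n + h)%N) ?(half_turn i h) //; [lra|lia].
Qed.

Lemma centered_sum_mul i h x q : h%:R * limit_shift i = len i / 2 :> R ->
  cell i x -> \sum_(0 <= k < q * (2 * h)) (\1_A (iter k tau x) - 2^-1) = 0 :> R.
Proof.
move=> hd ix; elim: q => [|q IHq]; first by rewrite mul0n big_nil.
by rewrite mulSn addnC (centered_sum_period i).
Qed.

(** Reducing n modulo 2 h leaves fewer than 2 h terms, each at most 1/2 in absolute value. *)
Lemma centered_sum_bound i h x n : (0 < h)%N ->
  h%:R * limit_shift i = len i / 2 :> R -> cell i x ->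
  `|\sum_(0 <= k < n) (\1_A (iter k tau x) - 2^-1) : R| <= h%:R.
Proof.
move=> h0 hd ix; have h20 : (0 < 2 * h)%N by lia.
have [n' [lt ->]] : exists n', (n' < 2 * h)%N /\
    \sum_(0 <= k < n) (\1_A (iter k tau x) - 2^-1) =
    \sum_(0 <= k < n') (\1_A (iter k tau x) - 2^-1) :> R.
  exists (n %% (2 * h))%N; split; first by rewrite ltn_mod.
  rewrite {1}(divn_eq n (2 * h)) addnC; move: (n %% _)%N => n'.
  elim: (n %/ _)%N => [|q IHq]; first by rewrite mul0n addn0.
  by rewrite mulSn (addnC (2 * h)%N) addnA (centered_sum_period i).
apply: le_trans (ler_norm_sum _ _ _) _.
apply: (@le_trans _ _ (\sum_(0 <= k < n') 2^-1)).
  apply: ler_sum => k _; have /andP[? ?] := indic_bounds A (iter k tau x).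
  by rewrite ler_norml; lra.
rewrite sumr_const_nat subn0 -mulr_natl.
have : (n'%:R <= (2 * h)%:R :> R) by rewrite ler_nat ltnW.
rewrite natrM; lra.
Qed.

Lemma ergodic_avg_centered n x : (0 < n)%N -> ergodic_avg tau \1_A n x =
  2^-1 + n%:R^-1 * \sum_(0 <= k < n) (\1_A (iter k tau x) - 2^-1) :> R.
Proof.
move=> n0; rewrite ergodic_avgE sumrB sumr_const_nat subn0.
have nz : n%:R != 0 :> R by rewrite pnatr_eq0 -lt0n.
by rewrite -(mulr_natl 2^-1) mulrBr (mulrA n%:R^-1) mulVf // mul1r addrC subrK.
Qed.

Lemma ergodic_avg_bounds n x : 0 <= (ergodic_avg tau \1_A n x : R) <= 1.
Proof.
rewrite ergodic_avgE; have [->|n0] := posnP n;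
  first by rewrite invr0 mul0r lexx ler01.
have S0 : 0 <= \sum_(0 <= k < n) \1_A (iter k tau x) :> R.
  by apply: sumr_ge0 => k _; have /andP[] := indic_bounds A (iter k tau x).
rewrite mulr_ge0 ?invr_ge0 //= ler_pdivrMl ?ltr0n // mulr1.
rewrite -[leRHS]mulr1 mulr_natl -[in leRHS](subn0 n) -sumr_const_nat.
by apply: ler_sum => k _; have /andP[] := indic_bounds A (iter k tau x).
Qed.

(** * The limit of the averages *)

Definition halting_cells : set R := \bigcup_(i in halting) cell i.

Definition fstar x : R := if x \in halting_cells then 2^-1 else \1_A x.

Lemma fstar_halting i x : halting i -> cell i x -> fstar x = 2^-1.
Proof. by move=> hi ix; rewrite /fstar mem_set //; exists i. Qed.

Lemma fstar_not_halting i x : ~ halting i -> cell i x -> fstar x = \1_A x.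
Proof.
move=> hi ix; rewrite /fstar memNset // => -[j hj jx]; apply: hi.
by rewrite (cell_inj _ _ _ ix jx).
Qed.

Lemma fstar_bounds x : 0 <= fstar x <= 1.
Proof.
rewrite /fstar; case: ifP => _; last exact: indic_bounds.
by rewrite invr_ge0 ler0n invf_le1 ?ler1n.
Qed.

Lemma measurable_fstar : measurable_fun setT fstar.
Proof.
have mU : measurable halting_cells.
  by apply: bigcup_measurable => i _; exact: measurable_cell.
rewrite (_ : fstar = fun x => \1_halting_cells x * 2^-1 +
  (1 - \1_halting_cells x) * \1_A x).
  have mA' : measurable_fun setT (\1_A : R -> R).
    by apply: measurable_indic; exact: measurable_half_set.
  have mU' : measurable_fun setT (\1_halting_cells : R -> R).
    exact: measurable_indic.
  apply: measurable_funD; first exact: measurable_funM.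
  by apply: measurable_funM => //; exact: measurable_funB.
apply/funext => x; rewrite /fstar (indicE _ halting_cells).
by case: (_ \in _) => /=; ring.
Qed.

Lemma measurable_ergodic_avg n :
  measurable_fun setT (ergodic_avg tau (\1_A : R -> R) n).
Proof.
have mA := @measurable_half_set R.
apply: measurable_funM => //; apply: measurable_sum => k.
elim: k => [|k IHk]; first exact: measurable_indic.
rewrite [X in measurable_fun _ X](_ : _ =
  (iter k (koopman tau) (\1_A : R -> R)) \o tau) //.
by apply: measurableT_comp => //; exact: measurable_cell_rot.
Qed.

(** On a halting cell the error is at most h / n, on any other cell it is 0. The rank is uniform in
    x but depends on the cell through h. *)
Lemma ergodic_avg_cell i (e : R) : 0 < e -> exists n0, forall n x, (n0 <= n)%N
  ->
  cell i x -> `|ergodic_avg tau \1_A n x - fstar x| <= e.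
Proof.
move=> e0; have [hi|nhi] := pselect (halting i).
  have [h [h0 hd _]] := limit_shift_halting _ hi.
  exists (Num.truncn (h%:R / e)).+1 => n x nn ix.
  have n0 : (0 < n)%N by exact: leq_trans nn.
  rewrite (fstar_halting i) // ergodic_avg_centered // addrC addKr.
  rewrite normrM ger0_norm ?invr_ge0 // ler_pdivrMl ?ltr0n //.
  apply: le_trans (centered_sum_bound i h x n h0 hd ix) _.
  rewrite -ler_pdivrMr //; apply: le_trans (ltW (truncnS_gt _)) _.
  by rewrite ler_nat.
exists 1%N => n x n0 ix; rewrite (fstar_not_halting i) // ergodic_avgE.
rewrite (eq_bigr (fun=> \1_A x)) => [|k _].
  have nz : n%:R != 0 :> R by rewrite pnatr_eq0 -lt0n.
  by rewrite sumr_const_nat subn0 -(mulr_natl (\1_A x)) mulKf // subrr normr0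
    ltW.
rewrite (iter_tau i) // limit_shift_not_halting // mulr0 ?ltW ?len_gt0 //.
by rewrite /rotation addr0; move: ix; rewrite /cell /= => /andP[_ ->].
Qed.

(** Uniform convergence on the first K cells, with K chosen so that the rest has measure below eps^2
    / 2; the squared error is then below eps^2 / 2 + eps^2 / 4. *)
Lemma ergodic_avg_cvg : cvg_Lp 2 (ergodic_avg tau (\1_A : R -> R)) fstar.
Proof.
apply: cvg_LpP => eps eps0.
have [K hK] := half_exp_lt (eps ^+ 2 / 2)
  ltac:(by rewrite divr_gt0 // exprn_gt0).
have e0 : 0 < eps / 2 by rewrite divr_gt0.
have [n0 hn0] : exists n0, forall n x, (n0 <= n)%N -> 0 <= x < left_end K ->
    `|ergodic_avg tau \1_A n x - fstar x| <= eps / 2.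
  elim: K {hK} => [|K [n0 IHK]].
    by exists 0%N => n x _; rewrite left_end0; lra.
  have [n1 hn1] := ergodic_avg_cell K (eps / 2) e0.
  exists (maxn n0 n1) => n x; rewrite geq_max => /andP[nn0 nn1] /andP[x0 xK].
  case: (ltP x (left_end K)) => xlt; first by apply: IHK => //; rewrite x0.
  by apply: hn1 => //; rewrite /cell /= xlt.
exists n0 => n nn0.
apply: (lt_Lp_norm 2 _ set0 `[left_end K, 1]%classic 1 (eps / 2) (2^-1 ^+ K))
  => //.
- by apply: measurable_funB; [exact: measurable_ergodic_avg|exact:
    measurable_fstar].
- exact: negligible_set0.
- rewrite lebesgue_measure_itv /= lte_fin left_end_lt1 -EFinB lee_fin.
  by rewrite /left_end opprB addrC subrK.
- exact: ltW.
- move=> x _ _ _ /=; have := fstar_bounds x; have := ergodic_avg_bounds n x.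
  by rewrite ler_norml; lra.
- move=> x Ix _ xK /=; apply: hn0 => //.
  move: Ix xK; rewrite /I01 /= !in_itv /= => /andP[-> ->]; rewrite andbT /=.
  by move=> /negP; rewrite -ltNge.
rewrite powR1 mul1r !powR_mulrn ?(ltW e0) ?(ltW eps0) //.
by rewrite expr_div_n; have := exprn_gt0 2 eps0; move: hK; lra.
Qed.

Lemma in_Lp_fstar : in_Lp 2 fstar.
Proof.
apply: (bounded_in_Lp 2 _ 1) => //; first exact: measurable_fstar.
by move=> x _; have /andP[? ?] := fstar_bounds x; rewrite ger0_norm.
Qed.

(** If the program is still running at stage 4 n, then h > 4 n, so fewer than n steps move a point
    by at most an eighth of the cell and the first quarter stays inside the left half. *)
Lemma slow_cell i n : halting i -> ~~ halts i (4 * n) -> (0 < n)%N ->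
  exists2 m, (n <= m)%N & forall x, left_end i <= x < left_end i + len i / 4 ->
    ergodic_avg tau \1_A m x = 2^-1 /\ ergodic_avg tau \1_A n x = 1.
Proof.
move=> hi nh n0; have [h [h0 hd /(_ _ nh) hn]] := limit_shift_halting _ hi.
(* A whole number of periods, for which the average is exactly 1/2. *)
exists (n * (2 * h))%N; first by rewrite leq_pmulr // muln_gt0 h0.
move=> x xi; have li := @len_gt0 R i.
have ix : cell i x by move: xi; rewrite /cell /= left_endS; lra.
split.
  rewrite ergodic_avg_centered; last by rewrite !muln_gt0 n0 h0.
  by rewrite (centered_sum_mul i) // mulr0 addr0.
rewrite ergodic_avgE big_nat (eq_bigr (fun=> 1)) => [|k /andP[_ kn]].
  rewrite -big_nat sumr_const_nat subn0 mulVf // pnatr_eq0 -lt0n //.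
have /andP[d0 _] := @is_shift_limit R i.
have kd : k%:R * limit_shift i <= len i / 8 :> R.
  have : k%:R * 4 * limit_shift i <= h%:R * limit_shift i :> R.
    by rewrite ler_wpM2r // -natrM ler_nat; lia.
  by rewrite hd mulrAC; lra.
rewrite (iter_tau i) //; last by lra.
have kd0 : 0 <= k%:R * limit_shift i :> R by rewrite mulr_ge0.
rewrite (indic_half_set i); last by apply: rotation_cell => //; lra.
rewrite /rotation left_endS ifT; last lra.
by rewrite (_ : (_ < _)%R = true) //; lra.
Qed.

End dynamics.

(** * Noncomputability *)

Section noncomputability.
Context {R : realType}.
Implicit Types (x : R) (e n i m h k : nat) (E : set R).
Local Notation mu := (@lebesgue_measure R).
Local Notation A := (@half_set R).
Local Notation tau := (@tau R).
Local Notation fstar := (@fstar R).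

(** Running the program for N i steps would decide whether it halts. Rates of convergence, and the
    norm, are refuted in this form. *)
Lemma halts_bound_uncomputable (N : nat -> nat) : computable_nat N ->
  ~ (forall i, halting i -> halts i (N i)).
Proof.
move=> cN hN; have ch := computable_halts.
apply: (halts_undecidable (fun i => halts i (N i))).
  by apply: (computable_nat_comp2 (fun i s => halts i s : nat) id N ch) => //;
    computability.
move=> i; split => [/hN -> //|]; last by case E : (halts i (N i)) => // _;
  exists (N i).
Qed.

(** * No computable rate of convergence *)

Definition left_quarter i : set R := `[left_end i, left_end i + len i / 4[.

Lemma mu_left_quarter i : mu (left_quarter i) = (len i / 4)%:E.
Proof.
rewrite /left_quarter lebesgue_measure_itv /= lte_fin ltrDl divr_gt0 ?len_gt0
  //.
by rewrite -EFinB addrC addKr.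
Qed.

Lemma left_quarter_I01 i : left_quarter i `<=` @I01 R.
Proof.
move=> x; rewrite /left_quarter /I01 /= !in_itv /=.
have := @left_end_ge0 R i; have := @left_end_lt1 R i.+1; have := @len_gt0 R i.
rewrite left_endS; lra.
Qed.

Lemma ratr_eighth i : ratr (2^-1 ^+ (i + 4)) = len i / 8 :> R.
Proof. by rewrite ratr_half_exp /len exprD !exprS expr0; field. Qed.

Lemma avg_rate_Lp_uncomputable (p : R) : 1 <= p ->
  ~ (exists2 r, computable_rat_nat r & avg_rate_Lp p tau (\1_A : R -> R) r).
Proof.
move=> p1 [r cr [rpos rate]].
(* This is len i / 8, the gap 1/2 between the two averages of [slow_cell] times the measure len i /
   4 of the quarter cell. *)
pose eps i : rat := 2^-1 ^+ (i + 4).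
have eps0 i : 0 < eps i by rewrite exprn_gt0.
apply: (halts_bound_uncomputable (fun i => 4 * r (eps i))%N).
  have cre : computable_nat (fun i => r (eps i)).
    by apply: computable_rat_nat_comp => //; rewrite /eps; rat_computability.
  by computability.
move=> i hi; apply/negPn/negP => nh.
have [m nm avgs] := @slow_cell R i _ hi nh (rpos _ (eps0 i)).
have := rate _ (eps0 i) m nm; apply/negP; rewrite -leNgt ratr_eighth.
have -> : len i / 8 = 2^-1 * (len i / 4) :> R by lra.
apply: (ge_Lp_norm p _ (left_quarter i)) => //.
- by apply: measurable_funB; exact: measurable_ergodic_avg.
- exact: measurable_itv.
- exact: left_quarter_I01.
- exact: mu_left_quarter.
- have := @len_le_half R i; lra.
move=> x; rewrite /left_quarter /= in_itv /= => /avgs[-> ->].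
by rewrite ler_normr; apply/orP; right; lra.
Qed.

Lemma measurable_max_deviation n k :
  measurable_fun setT (max_deviation tau (\1_A : R -> R) n k).
Proof.
rewrite /max_deviation; elim: (index_iota n k.+1) => [|m s IHs].
  rewrite [X in measurable_fun _ X](_ : _ = cst 0) //.
  by apply/funext => x; rewrite big_nil.
under eq_fun do rewrite big_cons.
apply: measurable_maxr => //; apply: measurableT_comp => //.
by apply: measurable_funB; exact: measurable_ergodic_avg.
Qed.

Lemma avg_pointwise_rate_uncomputable :
  ~ (exists2 N, computable_rat2_nat N & avg_pointwise_rate tau (\1_A : R -> R)
    N).
Proof.
move=> [N cN rate].
pose eps i : rat := 2^-1 ^+ (i + 4).
have eps0 i : 0 < eps i by rewrite exprn_gt0.
(* The two tolerances are 1/4, below the gap 1/2 between the averages, and len i / 8, below the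
   measure len i / 4 of the quarter cell. *)
have quarter0 : 0 < 2^-1 ^+ 2 :> rat by rewrite exprn_gt0.
apply: (halts_bound_uncomputable (fun i => 4 * N (2^-1 ^+ 2) (eps i))%N).
  have [g cg gE] := computable_rat_half_exp (fun=> 2) (computable_nat_const 2).
  have [g' cg' g'E] := computable_rat_half_exp (fun i => i + 4)%N
    ltac:(computability).
  have cNe : computable_nat (fun i => N (2^-1 ^+ 2) (eps i)).
    have := computable_nat_comp _ (fun i => cpair (g i) (g' i)) cN
      ltac:(computability).
    apply: eq_computable_nat => i; rewrite !cpairE -gE -g'E //.
  by computability.
move=> i hi; apply/negPn/negP => nh; have [Npos bound] := rate _ _ quarter0
  (eps0 i).
have [m nm avgs] := @slow_cell R i _ hi nh Npos.
have := bound m nm; apply/negP; rewrite -ltNge ratr_eighth.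
set n := N _ _ in nm avgs *.
apply: (@lt_le_trans _ _ (mu (left_quarter i))).
  rewrite mu_left_quarter lte_fin; have := @len_gt0 R i; lra.
apply: le_measure; rewrite ?inE.
- exact: measurable_itv.
- rewrite (_ : [set x | _] = @I01 R `&` (max_deviation tau \1_A n m) @^-1`
    `]ratr (2^-1 ^+ 2), +oo[).
    have mdev : measurable_fun (@I01 R) (max_deviation tau (\1_A : R -> R) n m).
      exact: measurable_funS (measurable_max_deviation n m).
    exact: (mdev (@measurable_I01 R) _ (measurable_itv _)).
  by apply/seteqP; split => x /=; rewrite in_itv /= andbT.
move=> x xE; split; first exact: left_quarter_I01 xE.
have /avgs[am an] : left_end i <= x < left_end i + len i / 4.
  by move: xE; rewrite /left_quarter /= in_itv.
apply: (@lt_le_trans _ _ `|ergodic_avg tau \1_A m x - ergodic_avg tau \1_A n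
  x|).
  by rewrite am an ratr_half_exp ltr_normr; apply/orP; right; lra.
rewrite /max_deviation.
apply: (le_bigmax_seq 0 m xpredT (fun m => `|ergodic_avg tau \1_A m x -
  ergodic_avg tau \1_A n x|)) => //.
by rewrite mem_index_iota nm ltnS leqnn.
Qed.

(** * The limit is not computable in L2: integrals over half cells *)

Lemma bounded_integrable (f : R -> R) (M : R) E : measurable_fun setT f ->
  measurable E -> E `<=` @I01 R -> (forall x, I01 x -> `|f x| <= M) ->
  mu.-integrable E (EFin \o f).
Proof.
move=> mf mE EI fM; apply: measurable_bounded_integrable => //.
- apply: (@le_lt_trans _ _ (mu (@I01 R))); last by rewrite mu_I01_1 ltry.
  by apply: le_measure; rewrite ?inE //; exact: measurable_I01.
- exact: measurable_funS mf.
- exists M; split; first exact: num_real.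
  by move=> M' MM' x /EI /fM /le_trans; apply; exact: ltW.
Qed.

(* The Cauchy-Schwarz inequality against the indicator of E. *)
Lemma Rintegral_le_L2 (f : R -> R) (M c : R) E : measurable_fun setT f ->
  measurable E -> E `<=` @I01 R -> (forall x, I01 x -> `|f x| <= M) -> 0 <= c ->
  (Lp_norm 2 f <= c%:E)%E -> `|\int[mu]_(x in E) f x| <= c.
Proof.
move=> mf mE EI fM c0 fc; have If := bounded_integrable f M E mf mE EI fM.
rewrite -lee_fin EFin_normr_Rintegral //.
apply: le_trans (le_abse_integral _ _ _) _ => //; first by case/integrableP: If.
have mI := measurable_I01.
have mfI : measurable_fun setT (f \_ (@I01 R)).
  apply: (proj1 (@measurable_restrictT _ _ _ _ _ f measurable_I01)).
  exact: measurable_funS mf.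
have m1 : measurable_fun setT (\1_E : R -> R) by exact: measurable_indic.
have h2 : (2^-1 + 2^-1 = 1 :> R)%R by lra.
have := hoelder mu mfI m1 (ltr0n R 2) (ltr0n R 2) h2.
rewrite Lnorm1.
have -> : (\int[mu]_x `|(EFin \o ((f \_ (@I01 R)) \* \1_E)%R) x| =
  \int[mu]_(x in E) `|(f x)%:E|)%E.
  rewrite [RHS]integral_mkcond; apply: eq_integral => x _ /=.
  rewrite /patch indicE; have [xE|xE] := boolP (x \in E); last first.
    by rewrite mulr0 normr0.
  by rewrite mulr1 mem_set //; apply: EI; exact/set_mem.
move=> /le_trans; apply.
rewrite -[leRHS]mule1; apply: lee_pmul;
  [exact: Lnorm_ge0|exact: Lnorm_ge0|exact: fc|].
rewrite unlock /=.
have -> : (\int[mu]_x (`|(\1_E x)%:E| `^ 2) = mu E)%E.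
  rewrite -[in RHS](setIT E) -integral_indic //; apply: eq_integral => x _.
  rewrite indicE; case: (_ \in _).
    by rewrite /= normr1 powR1.
  by rewrite /= normr0 powR0.
rewrite -[leRHS](poweR1r 2^-1).
have E1 : (mu E <= 1)%E.
  by rewrite -mu_I01_1; apply: le_measure; rewrite ?inE //;
    exact: measurable_I01.
apply: gt0_ler_poweR; rewrite ?invr_ge0 //.
- by rewrite in_itv /= measure_ge0 leey.
- by rewrite in_itv /= lee01 leey.
Qed.

(** The integral of the e-th simple function over the left half of cell i, as a rational; the outer
    max treats intervals that miss the half cell. *)
Definition simple_integral e i : rat := \sum_(0 <= t < cfst e) term_coef e t *
  Num.max 0 (Num.min (term_hi e t) (left_rat i + 2^-1 ^+ i.+2) -
             Num.max (term_lo e t) (left_rat i)).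

Lemma computable_simple_integral (g : nat -> nat) : computable_nat g ->
  computable_rat_seq (fun i => simple_integral (g i) i).
Proof.
move=> cg; have ct : computable_nat2_nat term_code.
  by rewrite /term_code; computability.
apply: (computable_rat_sum (fun i t => term_coef (g i) t *
  Num.max 0 (Num.min (term_hi (g i) t) (left_rat i + 2^-1 ^+ i.+2) -
             Num.max (term_lo (g i) t) (left_rat i)))); last by computability.
rewrite /term_coef /term_lo /term_hi /left_rat; rat_computability.
Qed.

(** Closed, unlike [left_half], so that it meets the closed intervals of a simple function in closed
    intervals; only the midpoint is added. *)
Definition closed_half i : set R := `[left_end i, left_end i + len i / 2].

Lemma closed_half_cell i : closed_half i `<=` cell i.
Proof.
move=> x; rewrite /closed_half /cell /= in_itv /= left_endS.
have := @len_gt0 R i; lra.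
Qed.

Lemma closed_half_I01 i : closed_half i `<=` @I01 R.
Proof.
by move=> x /closed_half_cell/cell_sub; rewrite /I01 /= in_itv /=; lra.
Qed.

Lemma Rintegral_indic_itv (a b l r : R) : l <= r -> \int[mu]_(x in `[l, r])
  (\1_`[a, b] x : R) = Num.max 0 (Num.min b r - Num.max a l).
Proof.
move=> lr; rewrite /Rintegral integral_indic //.
rewrite (_ : `[a, b] `&` `[l, r] = `[Num.max a l, Num.min b r]%classic);
  last first.
  by apply/seteqP; split => x /=; rewrite !in_itv /= ge_max le_min; lra.
rewrite [X in fine X]lebesgue_measure_itv /= lte_fin.
case: ltP => h; last by rewrite /= [RHS]max_l // subr_le0.
by rewrite -EFinD /= [RHS]max_r // subr_ge0 ltW.
Qed.

Lemma Rintegral_simple_fun e i :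
  \int[mu]_(x in closed_half i) simple_fun e x = ratr (simple_integral e i) :>
    R.
Proof.
have mE : measurable (closed_half i) by exact: measurable_itv.
have li := @len_gt0 R i.
rewrite (@eq_Rintegral _ _ _ mu (closed_half i) (fun x => \sum_(0 <= t < cfst e)
  ratr (term_coef e t) * \1_(`[ratr (term_lo e t), ratr (term_hi e t)]) x));
  last by move=> x _; rewrite simple_funE.
rewrite /simple_integral rmorph_sum /=.
pose term t x : R :=
  ratr (term_coef e t) * \1_(`[ratr (term_lo e t), ratr (term_hi e t)]) x.
have mterm t : measurable_fun setT (term t).
  by apply: measurable_funM => //; exact: measurable_indic.
have term_le t x : `|term t x| <= `|ratr (term_coef e t)|.
  rewrite normrM ler_piMr // ger0_norm;
  by have /andP[] := indic_bounds `[ratr (term_lo e t), ratr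
    (term_hi e t)]%classic x.
have int0 a b : mu.-integrable (closed_half i)
  (EFin \o (\1_(`[a, b]) : R -> R)).
  apply: (bounded_integrable _ 1) => //; first exact: closed_half_I01.
  by move=> x _; have /andP[? ?] := indic_bounds `[a, b]%classic x;
    rewrite ger0_norm.
have int1 t : mu.-integrable (closed_half i) (EFin \o term t).
  apply: (bounded_integrable _ `|ratr (term_coef e t)|) => //;
    exact: closed_half_I01.
have ints s : mu.-integrable (closed_half i)
  (EFin \o fun x => \sum_(t <- s) term t x).
  apply: (bounded_integrable _ (\sum_(t <- s) `|ratr (term_coef e t)|)) => //.
  - exact: measurable_sum.
  - exact: closed_half_I01.
  - move=> x _; apply: le_trans (ler_norm_sum _ _ _) _; exact: ler_sum.
elim: (index_iota 0 (cfst e)) => [|t s IHs].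
  by rewrite big_nil (@eq_Rintegral _ _ _ mu (closed_half i) (fun=> 0))
    ?Rintegral_cst ?mul0r // => x _;
    rewrite big_nil.
rewrite big_cons -IHs (@eq_Rintegral _ _ _ mu (closed_half i)
  (fun x => ratr (term_coef e t) *
  \1_(`[ratr (term_lo e t), ratr (term_hi e t)]) x + \sum_(t <- s)
  ratr (term_coef e t) * \1_(`[ratr (term_lo e t), ratr (term_hi e t)]) x));
  last by move=> x _; rewrite big_cons.
rewrite RintegralD //.
- rewrite RintegralZl // Rintegral_indic_itv; last by lra.
  congr (_ + _); rewrite [RHS]rmorphM /= ratr_max rmorph0.
  rewrite [ratr (Num.min _ _ - _)]rmorphB /= ratr_min ratr_max.
  by rewrite ratr_half_end ratr_left_rat.
- exact: int1.
Qed.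

Lemma cvg_Lp_ex (p c : R) (u : nat -> R -> R) (f : R -> R) n : cvg_Lp p u f ->
  0 < c -> exists2 m, (n <= m)%N & (Lp_norm p (u m \- f)%R <= c%:E)%E.
Proof.
move=> /fine_cvgP[[n1 _ hfin] /cvgr0Pnorm_lt/[apply] -[n2 _ hlt]].
have hm1 : (n1 <= maxn n (maxn n1 n2))%N by lia.
have hm2 : (n2 <= maxn n (maxn n1 n2))%N by lia.
exists (maxn n (maxn n1 n2)); first exact: leq_maxl.
move: (hlt _ hm2) => /= /ltW lec; rewrite -(fineK (hfin _ hm1)) lee_fin.
exact: le_trans (ler_norm _) lec.
Qed.

Lemma fstar_halting_integral i : halting i ->
  \int[mu]_(x in closed_half i) fstar x = len i / 4.
Proof.
move=> hi; have li := @len_gt0 R i.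
rewrite (@eq_Rintegral _ _ _ mu (closed_half i) (fun=> 2^-1)); last first.
  by move=> x /set_mem /closed_half_cell ix; rewrite (fstar_halting i).
rewrite Rintegral_cst; last exact: measurable_itv.
rewrite [X in fine X]lebesgue_measure_itv /= lte_fin ltrDl divr_gt0 // -EFinD
  /=.
lra.
Qed.

Lemma fstar_not_halting_integral i : ~ halting i ->
  \int[mu]_(x in closed_half i) fstar x = len i / 2.
Proof.
move=> nhi; have li := @len_gt0 R i.
(* The midpoint is outside A; without it the integrand is constantly 1. *)
rewrite -Rintegral_itv_bndo_bndc; last first.
  apply: (bounded_integrable _ 1).
  - exact: measurable_fstar.
  - exact: measurable_itv.
  - move=> x xi; apply: (closed_half_I01 i); move: xi.
    by rewrite /closed_half /= !in_itv /= => /andP[-> /ltW ->].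
  - by move=> x _; have /andP[? ?] := fstar_bounds x; rewrite ger0_norm.
rewrite (@eq_Rintegral _ _ _ mu (left_half i) (fun=> 1)); last first.
  move=> x /set_mem xi; have ix := left_half_cell _ _ xi.
  rewrite (fstar_not_halting i) // (indic_half_set i) //.
  by move: xi; rewrite /left_half /= in_itv /= => /andP[_ ->].
rewrite Rintegral_cst; last exact: measurable_itv.
rewrite [X in fine X]lebesgue_measure_itv /= lte_fin ltrDl divr_gt0 // -EFinD
  /=.
lra.
Qed.

(** Done without the norm: integrals over the half cell become known within len i / 16. They are len
    i / 4 if the program halts and len i / 2 otherwise, and 3 len i / 8 separates the two cases. *)
Lemma fstar_uncomputable : ~ computable_Lp 2 fstar.
Proof.
move=> [_ [s [r [cs cr cvg rate]]]].
pose eps i : rat := 2^-1 ^+ (i + 5).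
have eps0 i : 0 < eps i by rewrite exprn_gt0.
have epsE i : ratr (eps i) = len i / 16 :> R.
  by rewrite ratr_half_exp /len exprD !exprS expr0; field.
pose g i := s (r (eps i)).
have cg : computable_nat g.
  have cre : computable_nat (fun i => r (eps i)).
    by apply: computable_rat_nat_comp => //; rewrite /eps; rat_computability.
  by rewrite /g; computability.
have mE i : measurable (closed_half i) by exact: measurable_itv.
have close i : `|ratr (simple_integral (g i) i) -
    \int[mu]_(x in closed_half i) fstar x| <= len i / 16 :> R.
  (* The rate only compares approximants with each other, so the limit is reached through a late
     approximant, at an arbitrarily small extra cost c. *)
  apply/ler_addgt0Pr => c c0.
  have [m nm hm] := cvg_Lp_ex 2 c _ _ (r (eps i)) cvg c0.
  have IB (f f' : R -> R) (M M' : R) c' : measurable_fun setT f ->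
      measurable_fun setT f' -> (forall x, I01 x -> `|f x| <= M) ->
      (forall x, I01 x -> `|f' x| <= M') -> 0 <= c' ->
      (Lp_norm 2 (f \- f')%R <= c'%:E)%E ->
      `|\int[mu]_(x in closed_half i) f x - \int[mu]_(x in closed_half i) f' x|
        <= c'.
    move=> mf mf' fM f'M c'0 ff'; rewrite -RintegralB //; first last.
    - by apply: (bounded_integrable _ M') => //; exact: closed_half_I01.
    - by apply: (bounded_integrable _ M) => //; exact: closed_half_I01.
    - exact: mE.
    apply: (Rintegral_le_L2 _ (M + M')) => //.
    - exact: measurable_funB.
    - exact: closed_half_I01.
    - by move=> x Ix; rewrite (le_trans (ler_normB _ _)) // lerD ?fM ?f'M.
  have h1 := IB _ _ _ _ _ (measurable_simple_fun (s m))
    (measurable_simple_fun (g i))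
    (fun x _ => simple_fun_le (s m) x) (fun x _ => simple_fun_le (g i) x) _
    (ltW (rate _ (eps0 i) m nm)).
  have h2 := IB _ _ _ 1 _ (measurable_simple_fun (s m)) (@measurable_fstar R)
    (fun x _ => simple_fun_le (s m) x) _ (ltW c0) hm.
  have {}h1 := h1 (ltac:(by rewrite ler0q ltW)).
  have {}h2 := h2 (ltac:(by move=> x _; have /andP[? ?] := fstar_bounds x;
    rewrite ger0_norm)).
  rewrite -Rintegral_simple_fun; rewrite epsE in h1.
  move: h1 h2; move: (\int[mu]_(x in _) _) (\int[mu]_(x in _) _)
    (\int[mu]_(x in _) _).
  move=> a b d; rewrite !ler_norml; lra.
apply: (halts_undecidable
  (fun i => (simple_integral (g i) i <= 3%:R * 2^-1 ^+ (i + 4)))).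
  have cI := computable_simple_integral g cg.
  by rewrite -/(computable_bool _); rat_computability.
have thresholdE i : ratr (3%:R * 2^-1 ^+ (i + 4)) = 3 * len i / 8 :> R.
  by rewrite rmorphM /= ratr_eighth ratr_nat mulrA.
move=> i; have := close i; have li := @len_gt0 R i.
split=> [hi|].
  have := close i; rewrite fstar_halting_integral // ler_norml => h.
  have -> // : simple_integral (g i) i <= 3%:R * 2^-1 ^+ (i + 4).
  by rewrite -(ler_rat R) thresholdE; lra.
case: leP => // le _; apply: contrapT => nhi.
have := close i; rewrite fstar_not_halting_integral // ler_norml => h.
by move: le; rewrite -(ler_rat R) thresholdE; lra.
Qed.

(** * The norm of the limit *)

Definition sq_mass i : R := if pselect (halting i) then len i / 4 else len i /
  2.

Lemma mu_cell i : mu (cell i) = (len i)%:E.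
Proof.
rewrite cellE lebesgue_measure_itv /= lte_fin left_endS ltrDl len_gt0 -EFinD.
by rewrite addrC addKr.
Qed.

Lemma mu_left_half i : mu (left_half i) = (len i / 2)%:E.
Proof.
rewrite lebesgue_measure_itv /= lte_fin ltrDl divr_gt0 ?len_gt0 // -EFinD.
by rewrite addrC addKr.
Qed.

Lemma cell_sq_integral i :
  (\int[mu]_(x in cell i) (`|fstar x| `^ 2)%:E = (sq_mass i)%:E)%E.
Proof.
have li := @len_gt0 R i; have mc := @measurable_cell R i.
rewrite /sq_mass; case: pselect => hi.
  rewrite (eq_integral (fun=> (4^-1)%:E)); last first.
    move=> x /set_mem ix; rewrite (fstar_halting i) // powR_mulrn //.
    by rewrite ger0_norm ?invr_ge0 // exprVn -natrX.
  by rewrite integral_cst // [X in (_ * X)%E]mu_cell -EFinM mulrC.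
transitivity (\int[mu]_(x in cell i) ((\1_(left_half i) x : R)%:E))%E.
  apply: eq_integral => x /set_mem ix;
    rewrite (fstar_not_halting i) // (indic_half_set i) //.
  rewrite indicE /left_half mem_setE in_itv /=.
  move: ix; rewrite /cell /= => /andP[-> _] /=.
  by case: ltP => _; rewrite ?normr1 ?normr0 ?powR1 ?powR0.
rewrite integral_indic //; last exact: measurable_itv.
rewrite setIidl; last by move=> x; exact: left_half_cell.
exact: mu_left_half.
Qed.

Local Notation sq_fstar := (fun x => (`|fstar x| `^ 2)%:E).

Lemma measurable_sq_fstar (D : set R) : measurable_fun D sq_fstar.
Proof. exact: measurable_funS (measurable_powR_norm 2 _ (@measurable_fstar R)).
  Qed.

Lemma initial_sq_integral n :
  (\int[mu]_(x in `[0%R, left_end n[) sq_fstar x =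
   (\sum_(0 <= k < n) sq_mass k)%:E)%E.
Proof.
elim: n => [|n IHn].
  by rewrite left_end0 set_itvE integral_set0 big_nil.
have mc := @measurable_cell R n.
have -> : `[0%R, left_end n.+1[%classic =
  `[0%R, left_end n[%classic `|` cell n :> set R.
  have := @left_end_ge0 R n; have := @left_end_le R n n.+1 (leqnSn n) => h1 h2.
  apply/seteqP; split => x; rewrite /cell /= !in_itv /=; last lra.
  by case: (ltP x (left_end n)) => ?; [left|right]; lra.
rewrite ge0_integral_setU //=.
- by rewrite [X in (X + _)%E]IHn [X in (_ + X)%E]cell_sq_integral big_nat_recr
    //= EFinD.
- exact: measurable_sq_fstar.
- by rewrite disj_set2E; apply/eqP/seteqP; split => x //=;
    rewrite /cell in_itv /=; lra.
Qed.

Definition fstar_norm : R := fine (Lp_norm 2 fstar).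

(** The squared norm is the total mass of the cells; as the limit function is at most 1, what lies
    beyond the first n cells is at most 2^-n. *)
Lemma fstar_norm_sq n : [/\ 0 <= fstar_norm, fstar_norm <= 1,
  \sum_(0 <= k < n) sq_mass k <= fstar_norm ^+ 2 &
  fstar_norm ^+ 2 <= \sum_(0 <= k < n) sq_mass k + 2^-1 ^+ n].
Proof.
have J0 (D : set R) : (0 <= \int[mu]_(x in D) sq_fstar x)%E.
  by apply: integral_ge0 => x _; rewrite lee_fin powR_ge0.
have Jtail m : (\int[mu]_(x in `[left_end m, 1%R]) sq_fstar x <=
  (2^-1 ^+ m)%:E)%E.
  apply: (@le_trans _ _ (\int[mu]_(x in `[left_end m, 1%R]) (cst 1%E x))%E).
    apply: ge0_le_integral => //.
    - exact: measurable_sq_fstar.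
    - move=> x _; have /andP[f0 f1] := fstar_bounds x.
      by rewrite lee_fin powR_mulrn // ger0_norm // exprn_ile1.
  rewrite integral_cst // mul1e [leLHS]lebesgue_measure_itv /= lte_fin
    left_end_lt1.
  by rewrite -EFinD lee_fin /left_end opprB addrC subrK.
have JE m : (\int[mu]_(x in @I01 R) sq_fstar x =
    (\sum_(0 <= k < m) sq_mass k)%:E + \int[mu]_(x in `[left_end m, 1%R])
      sq_fstar x)%E.
  rewrite -initial_sq_integral -ge0_integral_setU //=.
  - congr integral; have := @left_end_ge0 R m;
      have := @left_end_lt1 R m => h1 h2.
    apply/seteqP; split => x; rewrite /I01 /= !in_itv /=; last lra.
    by case: (ltP x (left_end m)) => ?; [left|right]; lra.
  - exact: measurable_sq_fstar.
  - by rewrite disj_set2E; apply/eqP/seteqP; split => x //=;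
      rewrite !in_itv /=; lra.
have [J JJ] : exists J : R, (\int[mu]_(x in @I01 R) sq_fstar x)%E = J%:E.
  exists (fine (\int[mu]_(x in @I01 R) sq_fstar x)%E).
  rewrite fineK // ge0_fin_numE // (JE 0%N) big_nil add0e.
  by apply: le_lt_trans (Jtail _) _; exact: ltry.
have Jge0 : 0 <= J by rewrite -lee_fin -JJ.
have normE : fstar_norm = Num.sqrt J.
  by rewrite /fstar_norm Lp_normE // JJ poweR_EFin /= powR12_sqrt.
have sumle m : \sum_(0 <= k < m) sq_mass k <= J.
  by rewrite -lee_fin -JJ (JE m) leeDl.
have lesum m : J <= \sum_(0 <= k < m) sq_mass k + 2^-1 ^+ m.
  by rewrite -lee_fin -JJ (JE m) EFinD leeD2l.
rewrite normE sqr_sqrtr // sqrtr_ge0; split => //.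
rewrite -[leRHS]sqrtr1 ler_wsqrtr //.
by have := lesum 0%N; rewrite big_nil expr0 add0r.
Qed.

(** The mass of a cell as guessed at stage m. It errs only upwards: it starts at half the cell
    length and drops to a quarter when the program is seen to halt. *)
Definition staged_mass m k : rat :=
  if halts k m then 2^-1 ^+ k.+3 else 2^-1 ^+ k.+2.

Lemma ratr_staged_mass m k :
  ratr (staged_mass m k) = (if halts k m then len k / 4 else len k / 2) :> R.
Proof.
by rewrite /staged_mass; case: ifP => _; rewrite ratr_half_exp /len !exprS;
  field.
Qed.

Lemma sq_mass_le m k : sq_mass k <= ratr (staged_mass m k).
Proof.
rewrite ratr_staged_mass /sq_mass; have := @len_gt0 R k.
case: pselect => hk /=; case: ifP => hm; try lra.
by case: hk; exists m.
Qed.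

Lemma staged_mass_late m k : halting k -> ~~ halts k m ->
  sq_mass k + len k / 4 <= ratr (staged_mass m k).
Proof.
rewrite ratr_staged_mass /sq_mass => hk /negbTE ->.
by have := @len_gt0 R k; case: pselect => //= _; lra.
Qed.

(** Finitely many halting programs have a common stage by which all have halted. *)
Lemma staged_mass_stable n : exists m, forall k, (k < n)%N ->
  ratr (staged_mass m k) = sq_mass k.
Proof.
suff [m hm] : exists m, forall k, (k < n)%N -> halting k -> halts k m.
  exists m => k kn; rewrite ratr_staged_mass /sq_mass.
  case: pselect => hk; first by rewrite hm.
  by case: ifP => // hkm; case: hk; exists m.
elim: n => [|n [m IHm]]; first by exists 0%N.
have [[s hs]|nh] := pselect (halting n); last first.
  by exists m => k; rewrite ltnS leq_eqVlt => /orP[/eqP -> //|]; exact: IHm.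
exists (maxn m s) => k; rewrite ltnS leq_eqVlt => /orP[/eqP ->|kn] hk.
  exact: halts_mono (leq_maxr _ _) hs.
exact: halts_mono (leq_maxl _ _) (IHm _ kn hk).
Qed.

(** Given an approximation of the norm, search for a stage m at which the guessed masses of the
    first i + 5 cells add up to nearly its square. Program i must have halted by then if it ever
    does, since otherwise its cell alone would make the guess too large. *)
Lemma fstar_norm_uncomputable : ~ computable_real fstar_norm.
Proof.
move=> [a [r [ca cr cvg rate]]].
(* This is len i / 64, fine enough to give the square of the norm within len i / 16. *)
pose eps i : rat := 2^-1 ^+ (i + 7).
have eps0 i : 0 < eps i by rewrite exprn_gt0.
pose b i := a (r (eps i)).
have cb : computable_rat_seq b.
  apply: computable_rat_comp => //; apply: computable_rat_nat_comp => //.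
  by rewrite /eps; rat_computability.
(* The cells left out have total length 2^-(i + 5) = len i / 16. *)
pose S i m := \sum_(0 <= k < i + 5) staged_mass m k.
pose P i m := S i m <= b i * b i + 2^-1 ^+ (i + 5).
have ch := computable_halts.
have cS : computable_rat_seq (fun z => S (cfst z) (csnd z)).
  apply: (computable_rat_sum (fun z k => staged_mass (csnd z) k)
    (fun z => cfst z + 5)%N).
    by rewrite /staged_mass; rat_computability.
  by computability.
have cbf : computable_rat_seq (fun z => b (cfst z)).
  by apply: computable_rat_comp => //; computability.
have cP : computable_bool (fun z => P (cfst z) (csnd z)).
  by rewrite /P; rat_computability.
have lenE i : 2^-1 ^+ (i + 5) = len i / 16 :> R.
  by rewrite /len exprD !exprS expr0; field.
have bnear i : `|fstar_norm - ratr (b i)| <= len i / 64.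
  have -> : len i / 64 = ratr (eps i) :> R.
    by rewrite ratr_half_exp /len exprD !exprS expr0; field.
  apply/ler_addgt0Pr => c c0.
  have /cvgrPdist_lt/(_ c c0)[n0 _ hn0] := cvg.
  pose m := maxn n0 (r (eps i)).
  have h1 : `|fstar_norm - ratr (a m)| < c by apply: hn0; exact: leq_maxl.
  have h2 : `|ratr (a m) - ratr (b i)| < ratr (eps i) :> R.
    rewrite -rmorphB -ratr_norm ltr_rat; apply: rate => //; exact: leq_maxr.
  move: h1 h2; rewrite ler_norml !ltr_norml; lra.
(* The norm lies in [0, 1], so the difference of squares is at most 3 times the difference. *)
have sqnear i : `|fstar_norm ^+ 2 - ratr (b i * b i)| <= len i / 16.
  have [x0 x1 _ _] := fstar_norm_sq 0; have := bnear i; have := @len_gt0 R i.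
  have := @len_le_half R i; rewrite rmorphM /=.
  move: fstar_norm (ratr (b i)) (len i) x0 x1 => x y l x0 x1 l2 l0.
  rewrite !ler_norml => /andP[h1 h2]. nra.
have ratrS i m : ratr (S i m) = \sum_(0 <= k < i + 5) ratr (staged_mass m k) :>
  R.
  by rewrite rmorph_sum.
have exP i : exists m, P i m.
  have [m hm] := staged_mass_stable (i + 5); exists m.
  rewrite /P -(ler_rat R) ratrS rmorphD /= ratr_half_exp lenE.
  rewrite big_nat (eq_bigr sq_mass) => [|k /andP[_ /hm] //]; rewrite -big_nat.
  have [_ _ h _] := fstar_norm_sq (i + 5); have := sqnear i.
  by rewrite ler_norml; lra.
apply: (halts_bound_uncomputable (fun i => ex_minn (exP i))).
  exact: computable_nat_minimize.
move=> i hi; case: ex_minnP => m Pm _; apply/negPn/negP => nh.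
move: Pm; rewrite /P -(ler_rat R) ratrS rmorphD /= ratr_half_exp lenE.
have [_ _ _ h] := fstar_norm_sq (i + 5); rewrite lenE in h.
apply/negP; rewrite -ltNge.
(* An unseen halt costs len i / 4, while squaring, the tail and the slack in [P] cost len i / 16
   each, together less. *)
have : \sum_(0 <= k < i + 5) sq_mass k + len i / 4 <=
    \sum_(0 <= k < i + 5) ratr (staged_mass m k).
  have i5 : (i < i + 5)%N by lia.
  rewrite !big_mkord (bigD1 (Ordinal i5)) //= [leRHS](bigD1 (Ordinal i5)) //=
    addrAC lerD //.
    exact: staged_mass_late.
  by apply: ler_sum => k _; exact: sq_mass_le.
have := sqnear i; have := @len_gt0 R i; rewrite ler_norml; lra.
Qed.

End noncomputability.

Theorem theorem5p1 (R : realType) :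
  exists (tau : R -> R) (A : set R) (fstar : R -> R),
    [/\ measure_preserving01 tau /\ computable_transformation tau,
        [/\ measurable A, A `<=` @I01 R & computable_measurable_fun (\1_A : R -> R)],
        in_Lp 2 fstar /\ cvg_Lp 2 (ergodic_avg tau \1_A) fstar
      & [/\ ~ computable_real (fine (Lp_norm 2 fstar)),
            ~ computable_Lp 2 fstar,
            ~ (exists2 r, computable_rat_nat r & avg_rate_Lp 2 tau \1_A r),
            ~ (exists2 r, computable_rat_nat r & avg_rate_Lp 1 tau \1_A r)
          & ~ (exists2 N, computable_rat2_nat N
                        & avg_pointwise_rate tau \1_A N)]].
Proof.
exists tau, half_set, fstar; split.
- split; last exact: computable_tau.
  exact/measure_preserving_cell_rot/is_shift_limit.
- split; [exact: measurable_half_set|exact: half_set_I01|exact: computable_half_set].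
- split; [exact: in_Lp_fstar|exact: ergodic_avg_cvg].
- split.
  + exact: fstar_norm_uncomputable.
  + exact: fstar_uncomputable.
  + by apply: avg_rate_Lp_uncomputable; rewrite ler1n.
  + exact: avg_rate_Lp_uncomputable.
  + exact: avg_pointwise_rate_uncomputable.
Qed.
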